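(* Let $f \in \mathbb{W}^{s,G}(\Omega)$. Then there exists a unique minimizer $u$ of $\mathcal{I}$ over $\mathcal{A}_{f}(\Omega)$. Moreover, a function $u \in \mathcal{A}_{f}(\Omega)$ is the minimizer of $\mathcal{I}$ over $\mathcal{A}_{f}(\Omega)$ if and only if it is the weak solution to $$\begin{cases}\mathcal{L}u=0 &\text{in }\Omega,\\ u=f&\text{in }\mathbb{R}^n\setminus\Omega.\end{cases}$$
   Context: Standing assumptions. $n\ge 2$, $\Omega\subset\mathbb{R}^n$ is a bounded domain, $0<s<1$. The function $g:[0,\infty)\to[0,\infty)$ is strictly increasing and continuous with $g(0)=0$, $\lim_{t\to\infty}g(t)=\infty$, and, with $G(t):=\int_0^t g(\tau)\,d\tau$, there are constants $1<p\le q<\infty$ such that $p\le \frac{tg(t)}{G(t)}\le q$ for all $t>0$. The kernel $K:\mathbb{R}^n\times\mathbb{R}^n\to(0,\infty]$ is measurable, symmetric ($K(x,y)=K(y,x)$), and satisfies $\frac{\lambda}{|x-y|^n}\le K(x,y)\le\frac{\Lambda}{|x-y|^n}$ for $x,y\in\mathbb{R}^n$, with constants $0<\lambda\le\Lambda$. The operator is $$\mathcal{L}v(x)=\mathrm{p.v.}\int_{\mathbb{R}^n}g\left(\frac{|v(x)-v(y)|}{|x-y|^s}\right)\frac{v(x)-v(y)}{|v(x)-v(y)|}K(x,y)\frac{dy}{|x-y|^s}.$$ (Here and below the expression $g(\cdot)\frac{v(x)-v(y)}{|v(x)-v(y)|}$ is $0$ when $v(x)=v(y)$.) Function spaces. $L^G(\Omega)$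 is the set of real-valued measurable $v$ on $\Omega$ with $\int_\Omega G(|v|)\,dx<\infty$. Put $C_\Omega:=(\Omega\times\mathbb{R}^n)\cup(\mathbb{R}^n\times\Omega)$. $\mathbb{W}^{s,G}(\Omega)$ is the set of measurable $v:\mathbb{R}^n\to\mathbb{R}$ with $v|_\Omega\in L^G(\Omega)$ and $\iint_{C_\Omega}G\left(\frac{|v(x)-v(y)|}{|x-y|^s}\right)\frac{dx\,dy}{|x-y|^n}<\infty$. Functions are identified when equal almost everywhere. For $f\in\mathbb{W}^{s,G}(\Omega)$, $\mathcal{A}_f(\Omega):=\{v\in\mathbb{W}^{s,G}(\Omega): v=f\text{ in }\mathbb{R}^n\setminus\Omega\}$. Energy. $\mathcal{I}[v]:=\iint_{C_\Omega}G\left(\frac{|v(x)-v(y)|}{|x-y|^s}\right)K(x,y)\,dx\,dy$ for $v\in\mathcal{A}_f(\Omega)$. A function $u\in\mathcal{A}_f(\Omega)$ is a minimizer of $\mathcal{I}$ over $\mathcal{A}_f(\Omega)$ if $\mathcal{I}[u]\le\mathcal{I}[v]$ for all $v\in\mathcal{A}_f(\Omega)$. Weak solution. $u\in\mathbb{W}^{s,G}(\Omega)$ is a weak solution to $\mathcal{L}u=0$ in $\Omega$ if $$\iint_{C_\Omega}g\left(\frac{|u(x)-u(y)|}{|x-y|^s}\right)\frac{u(x)-u(y)}{|u(x)-u(y)|}(\eta(x)-\eta(y))K(x,y)\frac{dx\,dy}{|x-y|^s}=0$$ for every $\eta\in\mathbb{W}^{s,G}(\Omega)$ with $\eta=0$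 in $\mathbb{R}^n\setminus\Omega$. A weak solution of the Dirichlet problem is a $u\in\mathcal{A}_f(\Omega)$ that is a weak solution to $\mathcal{L}u=0$ in $\Omega$. *)

(* Defs.v *)
From HB Require Import structures.
From mathcomp Require Import all_boot all_order all_algebra.
From mathcomp Require Import all_classical all_reals all_analysis.
From mathcomp Require Import measurable_realfun.

Set Implicit Arguments.
Unset Strict Implicit.
Unset Printing Implicit Defensive.

Import Order.TTheory GRing.Theory Num.Theory.
Import numFieldNormedType.Exports.

Local Open Scope classical_set_scope.
Local Open Scope ring_scope.

(* A copy of R^n carrying the product (i.e. Borel) sigma-algebra, generated by
   the coordinates.  The points themselves live in 'rV[R]_n. *)
Definition borelRn (R : realType) (n : nat) : Type := 'rV[R]_n.

Section borelRn.
Context (R : realType) (n : nat).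

Definition coordRn (i : 'I_n) (x : borelRn R n) : R := (x : 'rV[R]_n) ord0 i.

HB.instance Definition _ := Pointed.copy (borelRn R n) ('rV[R]_n).

Let G := g_sigma_preimage coordRn.

Let G_set0 : G set0. Proof. exact: sigma_algebra0. Qed.

Let G_setC A : G A -> G (~` A). Proof. exact: sigma_algebraC. Qed.

Let G_bigcup (F : _^nat) : (forall i, G (F i)) -> G (\bigcup_i F i).
Proof. exact: sigma_algebra_bigcup. Qed.

HB.instance Definition _ := @isMeasurable.Build default_measure_display
  (borelRn R n) G G_set0 G_setC G_bigcup.

End borelRn.

(* (x_0, (x_1, ..., x_n)) |-> (x_0, x_1, ..., x_n); here 'rV_(1 + n) is
   convertible to 'rV_n.+1. *)
Definition consRn (R : realType) (n : nat) (z : R * borelRn R n) :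
  borelRn R n.+1 := row_mx (z.1%:M : 'M[R]_1) (z.2 : 'rV[R]_n).

(* The n-fold product of the one-dimensional Lebesgue measure. *)
Fixpoint lebesgue_borelRn (R : realType) (n : nat) :
    set (borelRn R n) -> \bar R :=
  match n with
  | 0 => dirac ((0 : 'rV[R]_0) : borelRn R 0)
  | m.+1 => pushforward (@lebesgue_measure R \x @lebesgue_borelRn R m)%E
              (@consRn R m)
  end.

Section lebesgue_borelRn_measure.
Context (R : realType).

Lemma measurable_coordRn n (i : 'I_n) :
  measurable_fun [set: borelRn R n] (@coordRn R n i).
Proof.
move=> _ Y mY; rewrite setTI; apply: sub_sigma_algebra => /=.
rewrite -bigcup_seq/=; exists i => /=; first by rewrite mem_index_enum.
by exists Y => //; rewrite setTI.
Qed.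

Lemma measurable_fun_coordRnP d (T : measurableType d) n
    (f : T -> borelRn R n) :
  (forall i, measurable_fun [set: T] (@coordRn R n i \o f)) ->
  measurable_fun [set: T] f.
Proof.
move=> mf.
have sub : g_sigma_preimage (fun i => @coordRn R n i \o f) `<=` measurable.
  apply: smallest_sub; first exact: sigma_algebra_measurable.
  case: n => [|n] in f mf *; first by rewrite big_ord0.
  rewrite -bigcup_mkord_ord; apply: bigcup_sub => i Ii.
  by move=> A [B mB <-]; exact: mf.
by rewrite g_sigma_preimage_comp in sub; move=> _ A mA; apply: sub; exists A.
Qed.

Lemma coordRn_consRn0 n z : @coordRn R n.+1 ord0 (consRn z) = z.1.
Proof.
have /= := @row_mxEl R 1 1 n (z.1%:M) z.2 ord0 ord0.
rewrite [in RHS]mxE eqxx mulr1n => <-; rewrite /coordRn /consRn.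
by congr (fun_of_matrix _ _ _); exact: val_inj.
Qed.

Lemma coordRn_consRnS n (j : 'I_n) z :
  @coordRn R n.+1 (lift ord0 j) (consRn z) = coordRn j z.2.
Proof.
have /= := @row_mxEr R 1 1 n (z.1%:M) z.2 ord0 j.
rewrite /coordRn => <-; rewrite /consRn.
by congr (fun_of_matrix _ _ _); exact: val_inj.
Qed.

Lemma measurable_consRn n :
  measurable_fun [set: R * borelRn R n] (@consRn R n).
Proof.
apply: measurable_fun_coordRnP => i; have [j ->|->] := unliftP ord0 i.
- rewrite (_ : _ \o _ = @coordRn R n j \o snd).
    by apply: measurableT_comp => //; exact: measurable_coordRn.
  by apply/funext => z; exact: coordRn_consRnS.
- rewrite (_ : _ \o _ = fst); first exact: measurable_fst.
  by apply/funext => z; exact: coordRn_consRn0.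
Qed.

Definition unconsRn n (x : borelRn R n.+1) : R * borelRn R n :=
  (coordRn ord0 x, \row_j coordRn (lift ord0 j) x).

Lemma consRnK n : cancel (@consRn R n) (@unconsRn n).
Proof.
move=> [x y]; rewrite /unconsRn coordRn_consRn0/=; congr pair.
by apply/rowP => j; rewrite mxE coordRn_consRnS.
Qed.

Lemma measurable_unconsRn n : measurable_fun [set: borelRn R n.+1] (@unconsRn n).
Proof.
apply/measurable_fun_pair; first exact: measurable_coordRn.
apply: measurable_fun_coordRnP => i.
rewrite (_ : _ \o _ = @coordRn R n.+1 (lift ord0 i)).
  exact: measurable_coordRn.
by apply/funext => x/=; rewrite [LHS]mxE.
Qed.

Let lebesgue_borelRn_spec n :
  exists mu : {sigma_finite_measure set (borelRn R n) -> \bar R},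
    (mu : set (borelRn R n) -> \bar R) = @lebesgue_borelRn R n.
Proof.
elim: n => [|n [mu /= muE]].
  by exists (dirac ((0 : 'rV[R]_0) : borelRn R 0)).
pose nu : {measure set (measurableTypeR R * borelRn R n)%type -> \bar R} :=
  (@lebesgue_measure R \x mu)%E.
have sf : sigma_finite [set: borelRn R n.+1] (pushforward nu (@consRn R n)).
  have /sigma_finiteP[F [TF ndF Foo]] := sigma_finiteT (@lebesgue_measure R).
  have /sigma_finiteP[G [TG ndG Goo]] := sigma_finiteT mu.
  exists (fun k => @unconsRn n @^-1` (F k `*` G k)).
    rewrite -preimage_bigcup -(preimage_setT (@unconsRn n)); congr preimage.
    apply/seteqP; split => // -[x y] _.
    have [k _ Fkx] : (\bigcup_k F k) x by rewrite -TF.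
    have [l _ Gly] : (\bigcup_k G k) y by rewrite -TG.
    exists (maxn k l) => //; split => /=.
    - by move: x Fkx; exact/subsetPset/ndF/leq_maxl.
    - by move: y Gly; exact/subsetPset/ndG/leq_maxr.
  move=> k; have [mF Fkoo] := Foo k; have [mG Gkoo] := Goo k; split.
    rewrite -[X in measurable X]setTI; apply: measurable_unconsRn => //.
    exact: measurableX.
  rewrite /pushforward -comp_preimage (_ : _ \o _ = id); last first.
    by apply/funext => z; exact: consRnK.
  rewrite preimage_id [X in (X < _)%E](product_measure1E _ mu mF mG).
  by rewrite lte_mul_pinfty// ge0_fin_numE.
pose m0 : {measure set (borelRn R n.+1) -> \bar R} :=
  measure_function_pushforward__canonical__measure_function_Measure
    nu (@measurable_consRn n).
pose m1 := Measure_isSigmaFinite.Build _ _ _ m0 sf.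
pose m2 : {sigma_finite_measure set (borelRn R n.+1) -> \bar R} :=
  HB.pack (Measure.sort m0) (Measure.class m0) m1.
by exists m2; rewrite /= -muE.
Qed.

Let lebesgue_borelRn0 n : @lebesgue_borelRn R n set0 = 0%E.
Proof. by have [mu <-] := lebesgue_borelRn_spec n; exact: measure0. Qed.

Let lebesgue_borelRn_ge0 n A : (0 <= @lebesgue_borelRn R n A)%E.
Proof. by have [mu <-] := lebesgue_borelRn_spec n; exact: measure_ge0. Qed.

Let lebesgue_borelRn_sigma_additive n :
  semi_sigma_additive (@lebesgue_borelRn R n).
Proof.
have [mu <-] := lebesgue_borelRn_spec n.
exact: measure_semi_sigma_additive.
Qed.

HB.instance Definition _ n := isMeasure.Build _ _ _ (@lebesgue_borelRn R n)
  (@lebesgue_borelRn0 n) (@lebesgue_borelRn_ge0 n)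
  (@lebesgue_borelRn_sigma_additive n).

Let sigma_finite_lebesgue_borelRn n :
  sigma_finite setT (@lebesgue_borelRn R n).
Proof. by have [mu <-] := lebesgue_borelRn_spec n; exact: sigma_finiteT. Qed.

HB.instance Definition _ n := Measure_isSigmaFinite.Build _ _ _
  (@lebesgue_borelRn R n) (@sigma_finite_lebesgue_borelRn n).

Lemma measurable_boxRn n (a b : 'I_n -> R) :
  measurable ([set x | forall i, a i <= coordRn i x <= b i] : set (borelRn R n)).
Proof.
rewrite (_ : [set _ | _] =
    \bigcap_(i in [set: 'I_n]) (@coordRn R n i @^-1` `[a i, b i])); last first.
  by apply/seteqP; split => x /= abx i => [_|]; rewrite /= ?in_itv;
    [exact: abx|have := abx i I; rewrite /= in_itv].
apply: fin_bigcap_measurable => // i _.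
by rewrite -[X in measurable X]setTI; exact: measurable_coordRn.
Qed.

Lemma lebesgue_borelRn_box n (a b : 'I_n -> R) : (forall i, a i <= b i) ->
  lebesgue_borelRn [set x : borelRn R n | forall i, a i <= coordRn i x <= b i] =
  (\prod_i (b i - a i))%:E.
Proof.
elim: n => [|n ih] in a b * => ab.
  by rewrite big_ord0 /= diracE mem_set//= => -[].
set S := [set _ | _].
have -> : lebesgue_borelRn S =
    (@lebesgue_measure R \x @lebesgue_borelRn R n)%E (@consRn R n @^-1` S) by [].
have -> : @consRn R n @^-1` S = `[a ord0, b ord0]%classic `*`
  [set x | forall i, a (lift ord0 i) <= coordRn i x <= b (lift ord0 i)].
  apply/seteqP; split => z; rewrite /S /=.
    move=> abz; split => [|i].
      by rewrite in_itv/=; have := abz ord0; rewrite coordRn_consRn0.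
    by have := abz (lift ord0 i); rewrite coordRn_consRnS.
  rewrite in_itv/= => -[ab0 abS] i; have [j ->|->] := unliftP ord0 i.
    by rewrite coordRn_consRnS.
  by rewrite coordRn_consRn0.
rewrite [LHS](product_measure1E _ (@lebesgue_borelRn R n) _
  (measurable_boxRn _ _))//.
transitivity (((b ord0 - a ord0)%:E *
    (\prod_(i < n) (b (lift ord0 i) - a (lift ord0 i)))%:E)%E); last first.
  by rewrite big_ord_recl EFinM.
congr (_ * _)%E; last by apply: ih => i; exact: ab.
rewrite [LHS]lebesgue_measure_itv/= lte_fin; case: ltP => // ba.
by rewrite (@le_anti _ R (a ord0) (b ord0)) ?subrr// ab.
Qed.

End lebesgue_borelRn_measure.

(* R^n and R^n x R^n equipped with the Lebesgue (i.e. completed) sigma-algebras,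
   and the Lebesgue measures on them (on R^n x R^n, the 2n-dimensional one). *)
Definition lebRn (R : realType) (n : nat) : measurableType _ :=
  caratheodory_type (@lebesgue_borelRn R n)^*%mu.

Definition lebRn2 (R : realType) (n : nat) : measurableType _ :=
  caratheodory_type (@lebesgue_borelRn R n \x @lebesgue_borelRn R n)%E^*%mu.

Definition lebesgueRn (R : realType) (n : nat) :
    {measure set (lebRn R n) -> \bar R} :=
  @completed_measure_extension _ _ _ (@lebesgue_borelRn R n).

Definition lebesgueRn2 (R : realType) (n : nat) :
    {measure set (lebRn2 R n) -> \bar R} :=
  @completed_measure_extension _ _ _
    (@lebesgue_borelRn R n \x @lebesgue_borelRn R n)%E.

Lemma lebesgueRn_box (R : realType) (n : nat) (a b : 'I_n -> R) :
  (forall i, a i <= b i) ->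
  lebesgueRn R n [set x : 'rV[R]_n | forall i, a i <= x ord0 i <= b i] =
  (\prod_i (b i - a i))%:E.
Proof.
move=> ab; rewrite -(lebesgue_borelRn_box ab).
exact: (measurable_mu_extE _ (measurable_boxRn a b)).
Qed.

(* The Euclidean norm; the norm `|x| of 'rV[R]_n is the sup norm. *)
Definition enorm (R : realType) (n : nat) (x : 'rV[R]_n) : R :=
  Num.sqrt (\sum_(i < n) x ord0 i ^+ 2).

Definition is_domain (R : realType) (n : nat) (Omega : set 'rV[R]_n) : Prop :=
  [/\ Omega !=set0, open Omega & connected Omega].

(* Functions on [0, +oo[ are represented by functions on R, of which only the
   values on [0, +oo[ matter. *)
Definition primitive (R : realType) (g : R -> R) (t : R) : R :=
  (\int[lebesgue_measure]_(tau in `[0, t]) g tau)%R.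

Record growth_condition (R : realType) (g : R -> R) (p q : R) : Prop := {
  growth_ge0 : forall t, 0 <= t -> 0 <= g t ;
  growth_incr : {in `[0, +oo[ &, {homo g : t u / t < u}} ;
  growth_cont : {within `[0, +oo[, continuous g} ;
  growth_at0 : g 0 = 0 ;
  growth_pinfty : g t @[t --> +oo] --> +oo ;
  growth_exponents : 1 < p <= q ;
  growth_bounds : forall t, 0 < t -> p <= t * g t / primitive g t <= q }.

(* In the bounds, c / |x - y|^n is +oo when x = y. *)
Record kernel_condition (R : realType) (n : nat) (lambda Lambda : R)
    (K : 'rV[R]_n -> 'rV[R]_n -> \bar R) : Prop := {
  kernel_meas : measurable_fun [set: lebRn2 R n] (fun z => K z.1 z.2) ;
  kernel_gt0 : forall x y, (0 < K x y)%E ;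
  kernel_sym : forall x y, K x y = K y x ;
  kernel_constants : 0 < lambda <= Lambda ;
  kernel_bounds : forall x y,
    (lambda%:E / (enorm (x - y) ^+ n)%:E <= K x y <=
     Lambda%:E / (enorm (x - y) ^+ n)%:E)%E }.

Section dirichlet_problem.
Context (R : realType) (n : nat) (Omega : set 'rV[R]_n) (s : R) (g : R -> R).
Context (K : 'rV[R]_n -> 'rV[R]_n -> \bar R).
Implicit Types u v f eta : 'rV[R]_n -> R.

Let G := primitive g.

Definition COmega : set (lebRn2 R n) :=
  (Omega `*` [set: 'rV[R]_n]) `|` ([set: 'rV[R]_n] `*` Omega).

Definition in_LG v : Prop :=
  measurable_fun (Omega : set (lebRn R n)) v /\
  (\int[lebesgueRn R n]_(x in Omega) (G `|v x|)%:E < +oo)%E.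

Definition diff_quot v (x y : 'rV[R]_n) : R :=
  `|v x - v y| / enorm (x - y) `^ s.

Definition in_WsG v : Prop :=
  [/\ measurable_fun [set: lebRn R n] v, in_LG v &
   (\int[lebesgueRn2 R n]_(z in COmega)
      (G (diff_quot v z.1 z.2) / enorm (z.1 - z.2) ^+ n)%:E < +oo)%E].

(* Functions are identified when equal almost everywhere, so that boundary
   conditions outside Omega hold almost everywhere. *)
Definition in_Af f v : Prop :=
  in_WsG v /\ v = f %[ae lebesgueRn R n in ~` Omega].

Definition energy v : \bar R :=
  (\int[lebesgueRn2 R n]_(z in COmega)
     ((G (diff_quot v z.1 z.2))%:E * K z.1 z.2))%E.

Definition is_minimizer f u : Prop :=
  in_Af f u /\ forall v, in_Af f v -> (energy u <= energy v)%E.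

(* The factor (u x - u y) / |u x - u y| is 0 when u x = u y, as 0^-1 = 0 in R. *)
Definition weak_form u eta : \bar R :=
  (\int[lebesgueRn2 R n]_(z in COmega)
     ((g (diff_quot u z.1 z.2) * ((u z.1 - u z.2) / `|u z.1 - u z.2|) *
       (eta z.1 - eta z.2))%:E * K z.1 z.2 *
      ((enorm (z.1 - z.2) `^ s)^-1)%:E))%E.

Definition weak_solution u : Prop :=
  in_WsG u /\
  forall eta, in_WsG eta ->
    eta = (fun=> 0) %[ae lebesgueRn R n in ~` Omega] -> weak_form u eta = 0%E.

Definition dirichlet_weak_solution f u : Prop := in_Af f u /\ weak_solution u.

End dirichlet_problem.

(* Main.v *)
Require Import Defs.
From mathcomp Require Import all_boot all_order all_algebra.
From mathcomp Require Import all_classical all_reals all_analysis.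
From mathcomp Require Import measurable_realfun.
From mathcomp Require Import ring lra.

Set Implicit Arguments.
Unset Strict Implicit.
Unset Printing Implicit Defensive.

Import Order.TTheory GRing.Theory Num.Theory.
Import numFieldNormedType.Exports.

Local Open Scope classical_set_scope.
Local Open Scope ring_scope.

(** Write Phi t = G |t|, phi for the derivative of Phi, and
    quot v (x, y) = (v x - v y) / |x - y|^s. The energy of v is the integral of
    Phi (quot v) against the kernel over COmega; since quot is linear and Phi is
    strictly convex, everything but existence is convexity.

    Convexity enters through the strict supporting-line inequality Phi_above. At
    a minimizer the one-sided derivatives of the energy are nonnegative in all
    admissible directions (first_variation_ge0), which gives the weak equation;
    conversely the integrated supporting line at a weak solution shows that it
    minimizes (functional_above). Two minimizers have equal quotients almost
    everywhere, so that their difference is constant, and this constant vanishes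
    because both equal f outside the bounded set Omega (minimizer_unique).

    Existence uses no weak compactness. Let midgap a b denote
    (Phi a + Phi b) / 2 - Phi ((a + b) / 2). Along a minimizing sequence the
    midpoint of two consecutive terms is admissible, so that the integral of
    their gap is at most the mean excess of their energies over the infimum. If
    the energies converge fast enough, the sum of the gaps with prescribed large
    weights is finite almost everywhere. As Phi grows at least
    linearly and its gaps are bounded below on bounded sets of pairs that are far
    apart (midgap_bounded_gt0), suitable weights force the quotients of the
    sequence to converge almost everywhere (midgap_cvg,
    minimizing_sequence_cvg). At a point x0 outside Omega all terms equal f x0;
    hence convergence of the quotients along the slice through x0 is convergence
    of the sequence itself. Fatou's lemma concludes.

    The limit lies in the fractional space because integrability over Omega is
    a consequence of finite energy: by Tonelli some slice of the energy density
    through a point x0 is integrable, and on the bounded set Omega it controls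
    v - v x0 (finite_functional_in_LG). Slicing is delicate as the sigma-algebras
    are completed: it rests on the representation of a function measurable for
    the completion by one measurable before completion, up to a null set
    (completed_representative, ae_section_integral_lty).

    The upper growth bound is used twice: it makes Phi doubling, so that finite
    energy is a linear condition (Phi_scale, Phi_quasiadditive), and it bounds
    the product phi a * c by Phi a + Phi c (normr_phiM_le), so that the weak form
    is integrable. *)

(** * The growth function and its even convex extension *)

Section growth_function.
Context (R : realType) (g : R -> R) (p q : R) (gP : growth_condition g p q).

Local Notation G := (primitive g).

Lemma growth_le a b : 0 <= a -> a <= b -> g a <= g b.
Proof.
move=> a0; rewrite le_eqVlt => /predU1P[->//|ab]; apply/ltW.
by apply: (growth_incr gP) => //; rewrite in_itv/= ?a0// (le_trans a0)// ltW.
Qed.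

Lemma growth_gt0 a : 0 < a -> 0 < g a.
Proof.
move=> a0; rewrite -(growth_at0 gP).
by apply: (growth_incr gP) => //; rewrite in_itv/= ?lexx// ltW.
Qed.

Lemma g_integrable a b : 0 <= a ->
  (@lebesgue_measure R).-integrable `[a, b] (EFin \o g).
Proof.
move=> a0; apply: continuous_compact_integrable; first exact: segment_compact.
apply: continuous_subspaceW (growth_cont gP).
by move=> x/=; rewrite !in_itv/= andbT => /andP[+ _]; exact: le_trans.
Qed.

Lemma primitive0 : G 0 = 0.
Proof. by rewrite /primitive set_itv1 Rintegral_set1. Qed.

Lemma primitiveB a b : 0 <= a -> a <= b ->
  G b - G a = \int[lebesgue_measure]_(t in `[a, b]) g t.
Proof.
move=> a0 ab; rewrite /primitive Rintegral_itvB ?bnd_simp//.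
  by rewrite Rintegral_itv_obnd_cbnd//; apply: integrableS (g_integrable b a0) => //;
    exact: subset_itv_oc_cc.
exact: g_integrable.
Qed.

Lemma primitive_bounds a b : 0 <= a -> a <= b ->
  g a * (b - a) <= G b - G a <= g b * (b - a).
Proof.
move=> a0 ab; rewrite primitiveB//.
have muab : fine (@lebesgue_measure R `[a, b]%classic) = b - a.
  by rewrite lebesgue_measure_itv/= lte_fin; case: ltP => //= ba;
    apply/esym/eqP; rewrite subr_eq0 eq_le ab ba.
have icst c : (@lebesgue_measure R).-integrable `[a, b] (EFin \o fun=> c).
  apply: continuous_compact_integrable; first exact: segment_compact.
  by move=> ?; exact: cvg_cst.
rewrite -muab -!Rintegral_cst//; apply/andP; split.
- apply: le_Rintegral => //; first exact: g_integrable.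
  by move=> x/=; rewrite in_itv/= => /andP[ax xb]; exact: growth_le.
- apply: le_Rintegral => //; first exact: g_integrable.
  move=> x/=; rewrite in_itv/= => /andP[ax xb]; apply: growth_le => //.
  exact: le_trans ax.
Qed.

(** Strictness comes from splitting the interval at its midpoint, where the
    growth function lies strictly between its end values. *)
Lemma primitive_above a b : 0 <= a -> 0 <= b -> a != b ->
  G a + g a * (b - a) < G b.
Proof.
move=> a0 b0; rewrite neq_lt => /orP[ab|ba].
- pose m := (a + b) / 2.
  have am : a < m by rewrite /m; lra.
  have mb : m < b by rewrite /m; lra.
  have /andP[+ _] := primitive_bounds a0 (ltW am).
  have /andP[+ _] := primitive_bounds (le_trans a0 (ltW am)) (ltW mb).
  have gam : g a < g m.
    by apply: (growth_incr gP) => //; rewrite in_itv/= ?a0// (le_trans a0)// ltW.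
  have : 0 < (g m - g a) * (b - m) by rewrite mulr_gt0 ?subr_gt0.
  by nra.
- pose m := (b + a) / 2.
  have bm : b < m by rewrite /m; lra.
  have ma : m < a by rewrite /m; lra.
  have m0 := le_trans b0 (ltW bm).
  have /andP[_ +] := primitive_bounds b0 (ltW bm).
  have /andP[_ +] := primitive_bounds m0 (ltW ma).
  have gma : g m < g a by apply: (growth_incr gP) => //; rewrite in_itv/= ?a0 ?m0.
  have : 0 < (g a - g m) * (m - b) by rewrite mulr_gt0 ?subr_gt0.
  by nra.
Qed.

Lemma q_gt1 : 1 < q.
Proof. by have /andP[p1 pq] := growth_exponents gP; exact: lt_le_trans pq. Qed.

Lemma primitive_gt0 t : 0 < t -> 0 < G t.
Proof.
move=> t0; have := primitive_above (lexx 0) (ltW t0) (negbT (lt_eqF t0)).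
by rewrite (growth_at0 gP) mul0r addr0 primitive0.
Qed.

Lemma growth_mul_le t : 0 <= t -> t * g t <= q * G t.
Proof.
rewrite le_eqVlt => /predU1P[<-|t0]; first by rewrite mul0r primitive0 mulr0.
by have /andP[_] := growth_bounds gP t0; rewrite ler_pdivrMr// primitive_gt0.
Qed.

Lemma primitive_le a b : 0 <= a -> a <= b -> G a <= G b.
Proof.
move=> a0 ab; have /andP[+ _] := primitive_bounds a0 ab.
have : 0 <= g a * (b - a) by rewrite mulr_ge0 ?(growth_ge0 gP)// subr_ge0.
by lra.
Qed.

(** With ratio r = 1 + 1/(2q), the upper growth bound gives
    G (r t) - G t <= (r - 1) t g (r t) <= G (r t) / 2; iterating this inequality
    reaches any dilation factor. *)
Lemma primitive_scale (c : R) (c0 : 0 <= c) : exists2 C : R, 1 <= C &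
  forall t, 0 <= t -> G (c * t) <= C * G t.
Proof.
pose r := 1 + (2 * q)^-1.
have q0 : 0 < q := lt_trans ltr01 q_gt1.
have r1 : 1 < r by rewrite ltrDl invr_gt0 mulr_gt0.
have rq : r * (2 * q) = 2 * q + 1 by rewrite /r mulrDl mul1r mulVf// gt_eqF// mulr_gt0.
have step t : 0 <= t -> G (r * t) <= 2 * G t.
  move=> t0; have tr : t <= r * t by rewrite ler_peMl// ltW.
  have rt0 := le_trans t0 tr.
  have /andP[_] := primitive_bounds t0 tr.
  have := growth_mul_le rt0; have := growth_ge0 gP rt0.
  have Grt : 0 <= G (r * t) by rewrite -primitive0 primitive_le.
  set gg := g _; set GG := G _ => gg0 h1 h2.
  have : 2 * q * (GG - G t) <= GG * q.
    have : 2 * q * (GG - G t) <= 2 * q * (gg * (r * t - t)).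
      by rewrite ler_wpM2l// mulr_ge0// ltW.
    have -> : 2 * q * (gg * (r * t - t)) = t * gg.
      by transitivity ((r * (2 * q) - 2 * q) * (t * gg)); [ring|rewrite rq; ring].
    have : t * gg <= r * t * gg by rewrite ler_wpM2r.
    by lra.
  by rewrite (mulrC _ q) -mulrA (mulrC GG) ler_pM2l//; lra.
have iter k t : 0 <= t -> G (r ^+ k * t) <= 2 ^+ k * G t.
  elim: k => [|k ih] in t * => t0; first by rewrite !mul1r.
  rewrite exprS -mulrA (le_trans (step _ _))//.
    by rewrite mulr_ge0// exprn_ge0// ltW// (lt_trans _ r1).
  by rewrite exprS -mulrA ler_pM2l// ih.
have [k ck] : exists k, c <= r ^+ k.
  have bern k : 1 + k%:R * (r - 1) <= r ^+ k.
    elim: k => [|k ih]; first by rewrite mul0r addr0.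
    have : (1 + k%:R * (r - 1)) * r <= r ^+ k * r by rewrite ler_pM2r// (lt_trans _ r1).
    rewrite -exprSr; apply: le_trans; rewrite -natr1.
    have : 0 <= k%:R * (r - 1) * (r - 1).
      by rewrite !mulr_ge0// subr_ge0 ltW.
    by lra.
  exists (Num.truncn (c / (r - 1))).+1; apply: le_trans (bern _).
  have := Num.Theory.truncnS_gt (c / (r - 1)).
  by rewrite ltr_pdivrMr ?subr_gt0//; lra.
exists (2 ^+ k) => [|t t0]; first by rewrite exprn_ege1// ler1n.
by apply: le_trans (iter k t t0); apply: primitive_le; [exact: mulr_ge0|exact: ler_wpM2r].
Qed.

(** The even extension of the primitive and its derivative, the odd extension of
    the growth function. *)
Definition Phi (t : R) : R := G `|t|.
Definition phi (t : R) : R := g `|t| * (t / `|t|).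

Lemma PhiE t : Phi t = G `|t|. Proof. by []. Qed.

Lemma phiE t : phi t = g `|t| * (t / `|t|). Proof. by []. Qed.

Lemma PhiN t : Phi (- t) = Phi t.
Proof. by rewrite /Phi normrN. Qed.

Lemma Phi0 : Phi 0 = 0.
Proof. by rewrite /Phi normr0 primitive0. Qed.

Lemma Phi_ge0 t : 0 <= Phi t.
Proof. by rewrite -primitive0 /Phi; apply: primitive_le. Qed.

Lemma le_Phi a b : `|a| <= `|b| -> Phi a <= Phi b.
Proof. by move=> ab; rewrite /Phi primitive_le. Qed.

Lemma phi_ge0E t : 0 <= t -> phi t = g t.
Proof.
rewrite le_eqVlt => /predU1P[<-|t0].
  by rewrite /phi normr0 mul0r mulr0 (growth_at0 gP).
by rewrite /phi gtr0_norm// divff ?mulr1// gt_eqF.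
Qed.

Lemma phiN t : phi (- t) = - phi t.
Proof. by rewrite /phi normrN mulNr mulrN. Qed.

Lemma normr_phi t : `|phi t| = g `|t|.
Proof.
have [t0|t0] := leP 0 t; first by rewrite (phi_ge0E t0) !ger0_norm// (growth_ge0 gP).
rewrite (ltr0_norm t0) -[t in LHS]opprK phiN normrN.
have nt0 : 0 <= - t by rewrite oppr_ge0 ltW.
by rewrite phi_ge0E// ger0_norm// (growth_ge0 gP).
Qed.

(** All the convexity used below is this strict supporting-line inequality. For
    b < 0 <= a it follows from the half-line case at - b, the supporting line
    being smaller at b than at - b. *)
Lemma Phi_above a b : a != b -> Phi a + phi a * (b - a) < Phi b.
Proof.
wlog a0 : a b / 0 <= a => [wl ab|].
  have [a0|a0] := leP 0 a; first exact: wl.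
  rewrite -[a]opprK phiN PhiN -(PhiN b).
  rewrite (_ : - phi (- a) * _ = phi (- a) * (- b - - a)); last by ring.
  by apply: wl; [rewrite oppr_ge0 ltW|rewrite eqr_opp].
move=> ab; rewrite phi_ge0E// {1}/Phi (ger0_norm a0).
have [b0|b0] := leP 0 b; first by rewrite /Phi (ger0_norm b0) primitive_above.
rewrite -(PhiN b) /Phi ger0_norm ?oppr_ge0 ?(ltW b0)//.
have nb0 : 0 <= - b by rewrite oppr_ge0 ltW.
have [->|anb] := eqVneq a (- b).
  have gb : 0 < g (- b) by rewrite growth_gt0// oppr_gt0.
  have : 0 < g (- b) * - b by rewrite mulr_gt0// oppr_gt0.
  by lra.
have := primitive_above a0 nb0 anb.
have : 0 <= g a * - b by rewrite mulr_ge0// (growth_ge0 gP).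
by lra.
Qed.

Lemma Phi_above_le a b : Phi a + phi a * (b - a) <= Phi b.
Proof.
have [->|ab] := eqVneq a b; first by rewrite subrr mulr0 addr0.
exact/ltW/Phi_above.
Qed.

Lemma continuous_phi : continuous phi.
Proof.
have cg (h : R -> R) : continuous h -> (forall x, 0 <= h x) -> continuous (g \o h).
  move=> ch h0 x; have /subspace_continuousP/(_ (h x)) := growth_cont gP.
  rewrite /= in_itv/= andbT => /(_ (h0 x)) gx.
  apply: cvg_comp gx => A [e e0 /= eA]; rewrite /nbhs/=.
  have := ch x; move/cvgrPdist_lt => /(_ e e0).
  by apply: filterS => y hxy; apply: eA => //=; rewrite in_itv/= h0.
(* splitting into positive and negative parts removes the division at 0 *)
have -> : phi = (g \o (fun t => Num.max t 0)) \- (g \o (fun t => Num.max (- t) 0)).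
  apply/funext => t /=; have [t0|t0] := leP 0 t.
    rewrite phi_ge0E// ?(max_l t0) max_r ?oppr_le0//.
    by rewrite (growth_at0 gP) subr0.
  rewrite -[t in LHS]opprK phiN phi_ge0E ?oppr_ge0 ?(ltW t0)//.
  rewrite ?(max_r (ltW t0)) max_l ?oppr_ge0 ?(ltW t0)//.
  by rewrite (growth_at0 gP) sub0r.
move=> x; apply: cvgB; apply: cg => [y|y].
- by apply: continuous_max; [exact: cvg_id|exact: cvg_cst].
- by rewrite le_max lexx orbT.
- by apply: continuous_max; [apply: cvgN; exact: cvg_id|exact: cvg_cst].
- by rewrite le_max lexx orbT.
Qed.

(** Squeezed between the supporting lines at a and at the moving point. *)
Lemma continuous_Phi : continuous Phi.
Proof.
move=> a.
have ba0 : b - a @[b --> a] --> 0.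
  by rewrite -(subrr a); apply: cvgB; [exact: cvg_id|exact: cvg_cst].
have up : Phi a + phi b * (b - a) @[b --> a] --> Phi a.
  have := cvgD (cvg_cst (Phi a)) (cvgM (@continuous_phi a) ba0).
  by rewrite mulr0 addr0; apply.
have dn : Phi a + phi a * (b - a) @[b --> a] --> Phi a.
  have := cvgD (cvg_cst (Phi a)) (cvgM (cvg_cst (phi a)) ba0).
  by rewrite mulr0 addr0; apply.
apply: squeeze_cvgr dn up.
by apply: nearW => b; rewrite Phi_above_le/=; have := Phi_above_le b a; lra.
Qed.

Lemma Phi_scale c : exists2 C : R, 0 <= C & forall t, Phi (c * t) <= C * Phi t.
Proof.
have [C C1 CG] := primitive_scale (normr_ge0 c); exists C; first exact: le_trans C1.
by move=> t; rewrite /Phi normrM CG.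
Qed.

Lemma Phi_quasiadditive : exists2 C : R, 0 <= C &
  forall a b, Phi (a + b) <= C * (Phi a + Phi b).
Proof.
have [C C0 CPhi] := Phi_scale 2; exists C => // a b.
wlog ab : a b / `|a| <= `|b| => [wl|].
  have [ab|/ltW ba] := leP `|a| `|b|; first exact: wl.
  by rewrite addrC (addrC (Phi a)) wl.
apply: (@le_trans _ _ (Phi (2 * b))).
  apply: le_Phi; rewrite (le_trans (ler_normD _ _))// normrM ger0_norm//.
  by move: ab; lra.
by rewrite (le_trans (CPhi b))// ler_wpM2l// lerDr Phi_ge0.
Qed.

(** A substitute for Young's inequality, obtained by comparing both factors to
    the larger of the two arguments. *)
Lemma normr_phiM_le a c : `|phi a * c| <= q * (Phi a + Phi c).
Proof.
rewrite normrM normr_phi; have q0 : 0 <= q by exact/ltW/(lt_trans ltr01 q_gt1).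
have [ca|ac] := leP `|c| `|a|.
  apply: (@le_trans _ _ (`|a| * g `|a|)).
    by rewrite mulrC ler_wpM2r// (growth_ge0 gP).
  by rewrite (le_trans (growth_mul_le _))// ler_wpM2l// lerDl Phi_ge0.
apply: (@le_trans _ _ (`|c| * g `|c|)).
  by rewrite mulrC ler_wpM2l// growth_le// ltW.
by rewrite (le_trans (growth_mul_le _))// ler_wpM2l// lerDr Phi_ge0.
Qed.

(** From the supporting line at 1. *)
Lemma Phi_linear_growth : exists2 c : R, 0 < c & forall t, c * (`|t| - 1) <= Phi t.
Proof.
exists (g 1); first exact: growth_gt0.
move=> t; rewrite -(_ : Phi `|t| = Phi t); last by rewrite /Phi normr_id.
have := Phi_above_le 1 `|t|; rewrite phi_ge0E//; apply: le_trans.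
by rewrite lerDr Phi_ge0.
Qed.

End growth_function.

(** * Uniform strict convexity on bounded sets *)

Section midpoint_gap.
Context (R : realType) (g : R -> R) (p q : R) (gP : growth_condition g p q).

Local Notation Phi := (Phi g).
Local Notation phi := (phi g).

Definition midgap (a b : R) : R := (Phi a + Phi b) / 2 - Phi ((a + b) / 2).

Lemma midgap_gt0 a b : a != b -> 0 < midgap a b.
Proof.
move=> ab; rewrite /midgap; set m := (a + b) / 2.
have ma : m != a by apply: contra_neq ab; rewrite /m; lra.
have mb : m != b by apply: contra_neq ab; rewrite /m; lra.
have := Phi_above gP ma; have := Phi_above gP mb.
rewrite (_ : phi m * (b - m) = - (phi m * (a - m))); first by lra.
by rewrite /m; field.
Qed.

Lemma midgap_ge0 a b : 0 <= midgap a b.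
Proof.
have [->|/midgap_gt0/ltW//] := eqVneq a b.
have bb : (b + b) / 2 = b by field.
by rewrite /midgap bb; lra.
Qed.

(** The gap is continuous and positive on the compact set of the pairs in a ball
    that are at distance at least e. *)
Lemma midgap_bounded_gt0 M e : 0 < e -> exists2 dlt : R, 0 < dlt &
  forall a b, `|a| <= M -> `|b| <= M -> e <= `|a - b| -> dlt <= midgap a b.
Proof.
move=> e0.
pose A := (`[- M, M] `*` `[- M, M]) `&` [set z : R * R | e <= `|z.1 - z.2|].
have [A0|/set0P A0] := eqVneq A set0.
  exists 1 => // a b aM bM abe; exfalso.
  suff : A (a, b) by rewrite A0.
  by split => //; split; rewrite /= in_itv/= -ler_norml.
have cA : compact A.
  apply: compact_closedI; first by apply: compact_setX; exact: segment_compact.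
  rewrite (_ : [set _ | _] = (fun z : R * R => `|z.1 - z.2|) @^-1` [set x | e <= x])//.
  apply: preimage_closed; last exact: closed_ge.
  by move=> z _; apply: cvg_norm; apply: cvgB; [exact: cvg_fst|exact: cvg_snd].
have cgap : continuous (fun z : R * R => midgap z.1 z.2).
  have cPhi (f : R * R -> R) : continuous f -> continuous (Phi \o f).
    by move=> cf z; apply: continuous_comp; [exact: cf|exact: (continuous_Phi gP)].
  move=> z; apply: cvgB.
    apply: cvgM; last exact: cvg_cst.
    apply: cvgD; [apply: (cPhi fst) => ?|apply: (cPhi snd) => ?].
      exact: cvg_fst.
    exact: cvg_snd.
  apply: (cPhi (fun z => (z.1 + z.2) / 2)) => ?; apply: cvgM; last exact: cvg_cst.
  by apply: cvgD; [exact: cvg_fst|exact: cvg_snd].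
have [[a b] /set_mem[_ /= abe] abmin] :=
  compact_EVT_min A0 cA (continuous_subspaceT cgap).
exists (midgap a b).
  by apply: midgap_gt0; rewrite -subr_eq0 -normr_gt0; exact: lt_le_trans abe.
move=> c d cM dM cde; apply: (abmin (c, d)); rewrite inE; split => //.
by split; rewrite /= in_itv/= -ler_norml.
Qed.

(** A sequence whose consecutive gaps are small compared with the moduli of
    convexity on slowly growing balls is Cauchy with geometric rate; S is
    arbitrary, so that this only requires finiteness of a weighted series. *)
Lemma midgap_cvg : exists2 c : nat -> R, (forall i, 0 < c i) &
  forall (a : nat -> R) (S : R), (forall i, Phi (a i) <= S * 2 ^+ i) ->
  (forall i, c i * midgap (a i) (a i.+1) <= S) -> cvgn a.
Proof.
have [k k0 kPhi] := Phi_linear_growth gP.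
pose M (i : nat) : R := i%:R * 2 ^+ i / k + 1.
have MS i j : (i <= j)%N -> M i <= M j.
  move=> ij; rewrite /M lerD2r ler_pM2r ?invr_gt0//.
  by rewrite ler_pM// ?ler_nat// ler_weXn2l// ler1n.
have /choice[dlt dltP] i : exists d : R, 0 < d /\ forall a b,
    `|a| <= M i -> `|b| <= M i -> 2^-1 ^+ i <= `|a - b| -> d <= midgap a b.
  have half_gt0 : 0 < 2^-1 :> R by rewrite invr_gt0.
  have [d d0 dP] := midgap_bounded_gt0 (M i) (exprn_gt0 i (half_gt0)).
  by exists d.
exists (fun i => i.+1%:R / dlt i.+1) => [i|a S PhiS gapS].
  by rewrite divr_gt0//; exact: (dltP _).1.
pose N := (Num.truncn S).+1.
have SN i : (N <= i)%N -> S < i%:R.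
  move=> Ni; apply: lt_le_trans (Num.Theory.truncnS_gt S) _.
  by rewrite ler_nat.
have aM i : (N <= i)%N -> `|a i| <= M i.
  move=> Ni; rewrite -lerBlDr ler_pdivlMr// mulrC (le_trans (kPhi _))//.
  by rewrite (le_trans (PhiS _))// ler_wpM2r ?exprn_ge0// ltW// SN.
have astep i : (N <= i)%N -> `|a i.+1 - a i| <= 2^-1 ^+ i.+1.
  move=> Ni; rewrite distrC leNgt; apply/negP => /ltW far.
  have [d0 /(_ (a i) (a i.+1))] := dltP i.+1.
  move=> /(_ (le_trans (aM i Ni) (MS _ _ (leqnSn i))) (aM _ (leqW Ni)) far).
  apply/negP; rewrite -ltNge.
  have : i.+1%:R * midgap (a i) (a i.+1) < i.+1%:R * dlt i.+1.
    rewrite -ltr_pdivrMr// mulrAC; apply: le_lt_trans (gapS i) _.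
    exact/SN/leqW.
  by rewrite ltr_pM2l.
apply/cvg_ex.
suff : cvgn [sequence a (n + N)%N]_n.
  by move=> /cvg_ex[l]; rewrite cvg_shiftn => al; exists l.
pose b n := a (n + N)%N.
suff : cvgn (series (telescope b)).
  rewrite telescopeK => cb; have : cvgn (fun n => (b n - b 0%N) + b 0%N).
    by apply: is_cvgD cb _; exact: is_cvg_cst.
  by under eq_fun do rewrite subrK.
apply: normed_cvg; apply: (@series_le_cvg _ _ (geometric 1 2^-1)).
- by move=> n; exact: normr_ge0.
- by move=> n; exact: geometric_ge0.
- move=> n; rewrite /geometric /mk_sequence mul1r /telescope/= /b addSn.
  apply: (le_trans (astep _ (leq_addl _ _))).
  by rewrite ler_wiXn2l ?invf_le1 ?ler1n// leqW// leq_addr.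
- by apply: is_cvg_geometric_series; rewrite ger0_norm// invf_lt1// ltr1n.
Qed.
End midpoint_gap.

(** * Completed measures *)

Section completion.
Context d (T : measurableType d) (R : realType).
Variable mu : {measure set T -> \bar R}.

Local Notation cT := (caratheodory_type (mu^*)%mu).
Local Notation cmu := (@completed_measure_extension _ T R mu).

Lemma completed_measurable (A : set T) : measurable A -> measurable (A : set cT).
Proof. exact: caratheodory_measurable_mu_ext. Qed.

Lemma completed_measureE (A : set T) : measurable A -> cmu A = mu A.
Proof. exact: measurable_mu_extE. Qed.

Lemma completed_negligible (N : set T) : mu.-negligible N -> cmu.-negligible N.
Proof.
move=> [A [mA A0 NA]]; exists A; split => //; first exact: completed_measurable.
by rewrite completed_measureE.
Qed.

(** Outer approximation: the intersection of countable covers whose total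
    measures tend to the outer measure. *)
Lemma measurable_hull (A : set T) : (mu^*%mu A < +oo)%E ->
  exists B, [/\ measurable B, A `<=` B & mu B = mu^*%mu A].
Proof.
move=> Aoo.
have /choice[F FP] (n : nat) : exists F : set T, [/\ measurable F, A `<=` F &
    (mu F <= mu^*%mu A + n.+1%:R^-1%:E)%E].
  have Afin : mu^*%mu A \is a fin_num by rewrite ge0_fin_numE// mu_ext_ge0.
  have n0 : 0 < n.+1%:R^-1 :> R by rewrite invr_gt0.
  have [_ [C [mC AC] <-] CA] := lb_ereal_inf_adherent n0 Afin.
  exists (\bigcup_k C k); split => //; first exact: bigcupT_measurable.
  apply: le_trans (ltW CA).
  by apply: measure_sigma_subadditive => //; exact: bigcupT_measurable.
exists (\bigcap_n F n).
have mF : measurable (\bigcap_n F n).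
  by apply: bigcapT_measurable => n; have [] := FP n.
have AF : A `<=` \bigcap_n F n by move=> x Ax n _; have [_ sub _] := FP n; exact: sub.
split => //; apply/eqP; rewrite eq_le; apply/andP; split; last first.
  by rewrite -(measurable_mu_extE mu mF) le_mu_ext.
apply/lee_addgt0Pr => _/posnumP[e]; near \oo => n.
have [mFn _ Fn] := FP n.
apply: (@le_trans _ _ (mu (F n))).
  by apply: le_measure; rewrite ?inE//; exact: bigcap_inf.
rewrite (le_trans Fn)// leeD// lee_fin ltW//.
by near: n; apply: near_infty_natSinv_lt.
Unshelve. all: by end_near. Qed.

Lemma negligible_completed (N : set T) : cmu.-negligible N -> mu.-negligible N.
Proof.
move=> [A [mA A0 NA]]; have [|B [mB AB B0]] := @measurable_hull A.
  by rewrite (_ : mu^*%mu A = 0%E) ?ltry.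
by exists B; split => //; [rewrite B0|exact: subset_trans AB].
Qed.

(** On pieces of finite measure the outer approximation exceeds the set by a
    null set; sigma-finiteness glues the pieces. *)
Lemma completed_measurable_hull (A : set cT) :
  sigma_finite [set: T] mu -> measurable A ->
  exists B : set T, [/\ measurable B, A `<=` B & mu.-negligible (B `\` A)].
Proof.
move=> [F FT /all_and2[mF Foo]] mA.
have /choice[B BP] n : exists B : set T, [/\ measurable B, A `&` F n `<=` B &
    mu.-negligible (B `\` (A `&` F n))].
  have mcF : measurable (F n : set cT) by exact: completed_measurable.
  have mAF : measurable (A `&` F n : set cT) by exact: measurableI.
  have AFoo : (cmu (A `&` F n) < +oo)%E.
    apply: (@le_lt_trans _ _ (cmu (F n))); last by rewrite completed_measureE.
    by apply: le_measure; rewrite ?inE.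
  have [B [mB AB muB]] := measurable_hull AFoo.
  have mcB : measurable (B : set cT) by exact: completed_measurable.
  have BE : cmu B = cmu (A `&` F n) by rewrite completed_measureE.
  have Boo : (cmu B < +oo)%E by rewrite BE.
  exists B; split => //; apply: negligible_completed.
  apply/negligibleP; first exact: measurableD.
  transitivity (cmu B - cmu (B `&` (A `&` F n)))%E; first exact: measureD.
  by rewrite setIidr// -BE subee// ge0_fin_numE.
exists (\bigcup_n B n); split.
- by apply: bigcupT_measurable => n; have [] := BP n.
- move=> x Ax; have [n _ Fnx] : (\bigcup_n F n) x by rewrite -FT.
  by exists n => //; have [_ sub _] := BP n; apply: sub.
- have : mu.-negligible (\bigcup_n (B n `\` (A `&` F n))).
    by apply: negligible_bigcup => n; have [] := BP n.
  apply: negligibleS => x [[n _ Bnx] Ax]; exists n => //; split => //.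
  by move=> [].
Qed.

Lemma measurable_id_completed : @measurable_fun _ _ cT T [set: cT] id.
Proof. by move=> _ A mA; rewrite setTI; exact: completed_measurable. Qed.

Lemma completed_measurable_fun d' (U : measurableType d') (f : T -> U) :
  measurable_fun [set: T] f -> measurable_fun [set: cT] f.
Proof.
by move=> mf _ A mA; rewrite setTI; apply: completed_measurable;
  rewrite -[X in measurable X]setTI; exact: mf.
Qed.

(** The measure is the image of its completion under the identity. *)
Lemma ge0_integral_completed (f : T -> \bar R) : measurable_fun [set: T] f ->
  (forall x, (0 <= f x)%E) -> (\int[cmu]_x f x = \int[mu]_x f x)%E.
Proof.
move=> mf f0.
have H := ge0_integral_pushforward measurable_id_completed cmu measurableT mf.
have {H} := H (fun x _ => f0 x); rewrite preimage_setT => <-.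
pose nu := measure_function_pushforward__canonical__measure_function_Measure
  cmu measurable_id_completed.
by apply: (@eq_measure_integral _ _ _ setT mu nu) => A mA _; exact: completed_measureE.
Qed.

Lemma completed_measure_complete : measure_is_complete cmu.
Proof. exact: measure_is_complete_caratheodory. Qed.

(** Modifying f on a single null set that corrects all the superlevel sets with
    rational thresholds makes it measurable before completion. *)
Lemma completed_representative (f : cT -> \bar R) :
  sigma_finite [set: T] mu -> measurable_fun [set: cT] f ->
  exists2 N : set T, measurable N /\ mu N = 0%E &
    measurable_fun [set: T] (fun x : T => if x \in N then 0%E else f x).
Proof.
move=> sf mf.
have /choice[B BP] (r : rat) : exists B : set T, [/\ measurable B,
    [set x | ((ratr r)%:E < f x)%E] `<=` B &
    mu.-negligible (B `\` [set x | ((ratr r)%:E < f x)%E])].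
  apply: completed_measurable_hull => //.
  rewrite (_ : mkset _ = f @^-1` `](ratr r)%:E, +oo[%classic); last first.
    by apply/seteqP; split => x /=; rewrite in_itv/= andbT.
  by rewrite -[X in measurable X]setTI; apply: mf => //; exact: emeasurable_itv.
pose D n := if unpickle n is Some r
  then B r `\` [set x | ((ratr r)%:E < f x)%E] else set0.
have [N [mN N0 DN]] : mu.-negligible (\bigcup_n D n).
  apply: negligible_bigcup => n; rewrite /D; case: unpickle => [r|].
    by have [] := BP r.
  exact: negligible_set0.
have BN r x : B r x -> ~ N x -> ((ratr r)%:E < f x)%E.
  move=> Bx Nx; apply: contra_notP Nx => fx; apply: DN.
  exists (pickle r); first exact: I.
  by rewrite /D pickleK; exact: conj Bx fx.
exists N => //.
apply: (measurability _ (ErealGenOInfty.measurableE R)) => // _ [_ [r ->] <-].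
rewrite setTI.
have -> : (fun x : T => if x \in N then 0%E else f x) @^-1` `]r%:E, +oo[%classic =
    (if r < 0 then N else set0) `|`
    ((\bigcup_(t in [set t : rat | r < ratr t]) B t) `\` N).
  apply/seteqP; split => x /=; rewrite in_itv/= andbT.
  - case: ifPn => [/set_mem Nx|/negP Nx]; first by rewrite lte_fin => ->; left.
    have {}Nx : ~ N x by move=> Nx'; apply: Nx; exact/mem_set.
    move=> rfx; right; split => //.
    have [t rt tf] : exists2 t : rat, r < ratr t & ((ratr t)%:E < f x)%E.
      case: (f x) rfx => [s|_|//].
        rewrite lte_fin => rs; have [t] := rat_in_itvoo rs.
        by rewrite in_itv/= => /andP[rt ts]; exists t.
      have r1 : r < r + 1 by rewrite ltrDl.
      have [t] := rat_in_itvoo r1.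
      by rewrite in_itv/= => /andP[rt _]; exists t => //; exact: ltry.
    by exists t => //; have [_ sub _] := BP t; exact: sub.
  - case=> [|[[t rt Btx] Nx]].
      by case: ifPn => // r0 Nx; rewrite mem_set// lte_fin.
    rewrite memNset//; apply: lt_trans (BN _ _ Btx Nx).
    by rewrite lte_fin.
apply: measurableU; first by case: ifP.
apply: measurableD => //; rewrite bigcup_mkcond.
by apply: bigcupT_measurable_rat => t; case: ifP => // _; have [] := BP t.
Qed.

End completion.

Section completed_product.
Context d1 d2 (T1 : measurableType d1) (T2 : measurableType d2) (R : realType).
Variables (m1 : {sigma_finite_measure set T1 -> \bar R})
  (m2 : {sigma_finite_measure set T2 -> \bar R}).

Local Notation m12 := (m1 \x m2)%E.
Local Notation cT1 := (caratheodory_type (m1^*)%mu).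
Local Notation cT2 := (caratheodory_type (m2^*)%mu).
Local Notation cT12 := (caratheodory_type (m12^*)%mu).
Local Notation cm1 := (@completed_measure_extension _ T1 R m1).
Local Notation cm2 := (@completed_measure_extension _ T2 R m2).
Local Notation cm12 := (@completed_measure_extension _ (T1 * T2)%type R m12).

Lemma sigma_finite_product : sigma_finite [set: T1 * T2] m12.
Proof.
have /sigma_finiteP[A [TA ndA Aoo]] := sigma_finiteT m1.
have /sigma_finiteP[B [TB ndB Boo]] := sigma_finiteT m2.
exists (fun n => A n `*` B n) => [|n]; last first.
  have [mA An] := Aoo n; have [mB Bn] := Boo n; split; first exact: measurableX.
  rewrite [X in (X < _)%E](_ : _ = (m1 (A n) * m2 (B n))%E).
    by rewrite lte_mul_pinfty// ge0_fin_numE.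
  exact: product_measure1E.
apply/seteqP; split => // -[x y] _.
have [i _ Ax] : (\bigcup_n A n) x by rewrite -TA.
have [j _ By] : (\bigcup_n B n) y by rewrite -TB.
exists (i + j)%N => //; split => /=.
- by move: x Ax; exact/subsetPset/ndA/leq_addr.
- by move: y By; exact/subsetPset/ndB/leq_addl.
Qed.

Lemma negligible_setXT (N : set T1) :
  m1.-negligible N -> m12.-negligible (N `*` [set: T2]).
Proof.
move=> [A [mA A0 NA]]; exists (A `*` [set: T2]); split.
- exact: measurableX.
- transitivity (m1 A * m2 setT)%E; last by rewrite A0 mul0e.
  exact: product_measure1E.
- by move=> x [/NA].
Qed.

Lemma negligible_setTX (N : set T2) :
  m2.-negligible N -> m12.-negligible ([set: T1] `*` N).
Proof.
move=> [A [mA A0 NA]]; exists ([set: T1] `*` A); split.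
- exact: measurableX.
- transitivity (m1 setT * m2 A)%E; last by rewrite A0 mule0.
  exact: product_measure1E.
- by move=> x [_ /NA].
Qed.

Lemma measurable_completed_diff d (T : measurableType d)
    (mu : {measure set T -> \bar R}) (A B : set T) : measurable B ->
  A `<=` B -> mu.-negligible (B `\` A) ->
  measurable (A : set (caratheodory_type (mu^*)%mu)).
Proof.
move=> mB AB N.
have -> : A = B `\` (B `\` A) by rewrite setDD setIidr.
apply: measurableD; first exact: completed_measurable.
exact/completed_measure_complete/completed_negligible.
Qed.

Lemma measurable_fst_completed : @measurable_fun _ _ cT12 cT1 [set: cT12] fst.
Proof.
move=> _ A mA; rewrite setTI.
have [B [mB AB N]] := completed_measurable_hull (sigma_finiteT m1) mA.
apply: (@measurable_completed_diff _ _ m12 _ (B `*` [set: T2])).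
- exact: measurableX.
- by move=> x Ax; split => //; exact: AB.
- apply: negligibleS (negligible_setXT N) => x [[Bx _] Ax].
  by split => //; split.
Qed.

Lemma measurable_snd_completed : @measurable_fun _ _ cT12 cT2 [set: cT12] snd.
Proof.
move=> _ A mA; rewrite setTI.
have [B [mB AB N]] := completed_measurable_hull (sigma_finiteT m2) mA.
apply: (@measurable_completed_diff _ _ m12 _ ([set: T1] `*` B)).
- exact: measurableX.
- by move=> x Ax; split => //; exact: AB.
- apply: negligibleS (negligible_setTX N) => x [[_ Bx] Ax].
  by split => //; split.
Qed.

Lemma ae_negligible_xsection (N : set (T1 * T2)) : m12.-negligible N ->
  {ae m1, forall x, m2.-negligible (xsection N x)}.
Proof.
move=> [A [mA A0 NA]].
have mf : measurable_fun [set: T1] (m2 \o xsection A).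
  exact: measurable_fun_xsection.
have : (\int[m1]_x `|(m2 \o xsection A) x| = 0)%E.
  by rewrite -A0; apply: eq_integral => x _; rewrite gee0_abs.
move=> /(ae_eq_integral_abs m1 measurableT mf); apply: filterS => x /(_ I) /= Ax.
exists (xsection A x); split => //; first exact: measurable_xsection.
by move=> y; rewrite /xsection/= => /set_mem Nxy; exact/mem_set/NA.
Qed.

(** Tonelli for the completed product: the integrand is replaced by a
    representative measurable for the product sigma-algebra, which differs from
    it on a set almost all of whose sections are null. *)
Lemma ae_section_integral_lty (h : T1 * T2 -> \bar R) :
  measurable_fun [set: cT12] h -> (forall z, (0 <= h z)%E) ->
  (\int[cm12]_z h z < +oo)%E ->
  {ae m1, forall x, measurable_fun [set: cT2] (fun y => h (x, y)) /\
    (\int[cm2]_y h (x, y) < +oo)%E}.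
Proof.
move=> mh h0 hoo.
have [N [mN N0] mh'] := completed_representative sigma_finite_product mh.
set h' := fun z => _ in mh'.
have h'0 z : (0 <= h' z)%E by rewrite /h'; case: ifP.
have h'h z : (h' z <= h z)%E by rewrite /h'; case: ifP.
have h'oo : (\int[m12]_z h' z < +oo)%E.
  rewrite -ge0_integral_completed//; apply: le_lt_trans hoo.
  apply: (@ge0_le_integral _ cT12 R cm12 [set: cT12]) => //.
  exact: completed_measurable_fun mh'.
have nN : m12.-negligible N by exact/negligibleP.
have mF := measurable_fun_fubini_tonelli_F (m2 := m2) h' mh' h'0.
have : (\int[m1]_x \int[m2]_y h' (x, y) < +oo)%E.
  by rewrite -fubini_tonelli1.
move=> Foo.
have iF : m1.-integrable [set: T1] (fubini_F m2 h').
  apply/integrableP; split => //; apply: le_lt_trans Foo.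
  apply: ge0_le_integral => //; first exact: measurableT_comp.
  by move=> x _; rewrite gee0_abs// integral_ge0.
have := integrable_ae measurableT iF.
apply: filterS2 (ae_negligible_xsection nN) => x nNx /(_ I) Fx.
have mh'x : measurable_fun [set: T2] (fun y => h' (x, y)).
  exact: measurableT_comp.
have mh'cx : measurable_fun [set: cT2] (fun y => h' (x, y)).
  exact: completed_measurable_fun.
have hh' : ae_eq cm2 [set: cT2] (fun y => h' (x, y)) (fun y => h (x, y)).
  apply: negligibleS (completed_negligible nNx) => y /= /not_implyP[_ neq].
  rewrite /xsection/=; apply: contrapT => Nxy; apply: neq.
  by rewrite /h' ifF//; exact/negP.
have mhx : measurable_fun [set: cT2] (fun y => h (x, y)).
  apply: (ae_measurable_fun _ hh') => //; exact: completed_measure_complete.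
split => //.
have <- : (\int[cm2]_y h' (x, y) = \int[cm2]_y h (x, y))%E.
  apply: (@ae_eq_integral _ cT2 R cm2 [set: cT2]); first exact: measurableT.
  - exact: mh'cx.
  - exact: mhx.
  - exact: hh'.
by rewrite ge0_integral_completed//; move: Fx; rewrite ge0_fin_numE// integral_ge0.
Qed.

End completed_product.

(** * Weighted convex integral functionals *)

Section convex_functional.
Context d (T : measurableType d) (R : realType).
Variables (mu : {measure set T -> \bar R}) (D : set T) (mD : measurable D).
Context (g : R -> R) (p q : R) (gP : growth_condition g p q).
Variables (k : T -> R) (mk : measurable_fun D k) (k0 : forall z, 0 <= k z).
Implicit Types a b c : T -> R.

Local Notation Phi := (Phi g).
Local Notation phi := (phi g).
Local Notation midgap := (midgap g).
Local Notation "'int' f" := (mu.-integrable D (fun z => (f z)%:E))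
  (at level 10, f at level 8).

(** Measurability of the argument is part of finiteness, as that of the density
    does not imply it. *)
Definition finite_functional a : Prop :=
  measurable_fun D a /\ int (fun z => Phi (a z) * k z).

Definition functional a : R := (\int[mu]_(z in D) (Phi (a z) * k z))%R.

Lemma measurable_Phi : measurable_fun [set: R] Phi.
Proof. by apply: continuous_measurable_fun; exact: continuous_Phi gP. Qed.

Lemma measurable_phi : measurable_fun [set: R] phi.
Proof. by apply: continuous_measurable_fun; exact: continuous_phi gP. Qed.

Lemma measurable_density a : measurable_fun D a ->
  measurable_fun D (fun z => Phi (a z) * k z).
Proof.
move=> ma; apply: measurable_funM => //.
by apply: measurableT_comp => //; exact: measurable_Phi.
Qed.

Lemma density_ge0 t z : 0 <= Phi t * k z.
Proof. by rewrite mulr_ge0// (Phi_ge0 gP). Qed.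

Lemma finite_functional_lty a : measurable_fun D a ->
  (\int[mu]_(z in D) (Phi (a z) * k z)%:E < +oo)%E -> finite_functional a.
Proof.
move=> ma aoo; split => //; apply/integrableP; split.
  exact/measurable_EFinP/measurable_density.
rewrite (eq_integral (fun z => (Phi (a z) * k z)%:E))// => z _.
by rewrite gee0_abs// lee_fin density_ge0.
Qed.

Lemma functionalE a : finite_functional a ->
  (functional a)%:E = (\int[mu]_(z in D) (Phi (a z) * k z)%:E)%E.
Proof. by move=> [ma ia]; rewrite fineK//; exact: integrable_fin_num. Qed.

Lemma integrable_dominated (f h : T -> R) : measurable_fun D f ->
  (forall z, D z -> `|f z| <= h z) -> int h -> int f.
Proof.
move=> mf fh ih; apply: le_integrable ih => //; first exact/measurable_EFinP.
by move=> z Dz; rewrite !abse_EFin lee_fin (le_trans (fh z Dz))// ler_norm.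
Qed.

Lemma integrable_linear (f h : T -> R) (r t : R) : int f -> int h ->
  int (fun z => r * f z + t * h z).
Proof.
move=> /(integrableZl mD r) iF /(integrableZl mD t) ih.
have := integrableD mD iF ih.
by apply: eq_integrable => // z _; rewrite /= !EFinM EFinD !EFinM.
Qed.

Lemma finite_functionalD a b : finite_functional a -> finite_functional b ->
  finite_functional (fun z => a z + b z).
Proof.
move=> [ma ia] [mb ib]; have [C C0 CP] := Phi_quasiadditive gP.
have mab : measurable_fun D (fun z => a z + b z) by exact: measurable_funD.
split => //; apply: integrable_dominated (integrable_linear C C ia ib) => [|z _ /=].
  exact: measurable_density.
rewrite ger0_norm ?density_ge0//.
by rewrite -mulrDr -mulrDl mulrA ler_wpM2r.
Qed.

Lemma finite_functionalZ r a : finite_functional a ->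
  finite_functional (fun z => r * a z).
Proof.
move=> [ma ia]; have [C C0 CP] := Phi_scale gP r.
have mra : measurable_fun D (fun z => r * a z) by exact: measurable_funM.
split => //; apply: integrable_dominated (integrable_linear C 0 ia ia) => [|z _ /=].
  exact: measurable_density.
by rewrite mul0r addr0 ger0_norm ?density_ge0// mulrA ler_wpM2r.
Qed.

Lemma finite_functional_mid a b : finite_functional a -> finite_functional b ->
  finite_functional (fun z => (a z + b z) / 2).
Proof.
move=> ia ib; have := finite_functionalZ 2^-1 (finite_functionalD ia ib).
by under eq_fun do rewrite mulrC.
Qed.

Lemma integrable_phiM a c : finite_functional a -> finite_functional c ->
  int (fun z => phi (a z) * c z * k z).
Proof.
move=> [ma ia] [mc ic].
apply: integrable_dominated (integrable_linear q q ia ic) => [|z _ /=].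
  apply: measurable_funM => //; apply: measurable_funM => //.
  by apply: measurableT_comp => //; exact: measurable_phi.
rewrite normrM (ger0_norm (k0 z)) -mulrDr -mulrDl mulrA ler_wpM2r//.
exact: normr_phiM_le gP _ _.
Qed.

Lemma functional_midgap a b : finite_functional a -> finite_functional b ->
  int (fun z => midgap (a z) (b z) * k z) /\
  (\int[mu]_(z in D) (midgap (a z) (b z) * k z))%R =
  (functional a + functional b) / 2 - functional (fun z => (a z + b z) / 2).
Proof.
move=> ia ib; have [_ im] := finite_functional_mid ia ib.
have iab := integrable_linear 2^-1 2^-1 ia.2 ib.2.
have gapE z : midgap (a z) (b z) * k z =
    2^-1 * (Phi (a z) * k z) + 2^-1 * (Phi (b z) * k z) -
    Phi ((a z + b z) / 2) * k z.
  by rewrite /midgap; field.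
split.
  have := integrableB mD iab im.
  by apply: eq_integrable => // z _; rewrite gapE.
under eq_Rintegral do rewrite gapE.
rewrite (RintegralB mD iab im).
rewrite (RintegralD mD (integrableZl mD 2^-1 ia.2) (integrableZl mD 2^-1 ib.2)).
rewrite (RintegralZl 2^-1 mD ia.2) (RintegralZl 2^-1 mD ib.2).
by rewrite -mulrDr mulrC.
Qed.

(** The supporting-line inequality, integrated. *)
Lemma functional_above a b : finite_functional a -> finite_functional b ->
  functional a + (\int[mu]_(z in D) (phi (a z) * (b z - a z) * k z))%R <=
  functional b.
Proof.
move=> ia ib.
have iba : finite_functional (fun z => b z - a z).
  have := finite_functionalD ib (finite_functionalZ (- 1) ia).
  by under eq_fun do rewrite mulN1r.
have iphi := integrable_phiM ia iba.
rewrite /functional -RintegralD//; [|exact: ia.2].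
apply: le_Rintegral => //; [|exact: ib.2|].
  have := integrable_linear 1 1 ia.2 iphi.
  by apply: eq_integrable => // z _; rewrite !mul1r.
by move=> z _; rewrite -mulrDl ler_wpM2r// (Phi_above_le gP).
Qed.

End convex_functional.

Local Opaque Phi phi midgap.

Section minimization.
Context d (T : measurableType d) (R : realType).
Variables (mu : {measure set T -> \bar R}) (D : set T) (mD : measurable D).
Context (g : R -> R) (p q : R) (gP : growth_condition g p q).
Variables (k : T -> R) (mk : measurable_fun D k) (k0 : forall z, 0 <= k z).
Implicit Types a b c : T -> R.

Local Notation Phi := (Phi g).
Local Notation phi := (phi g).
Local Notation midgap := (midgap g).
Local Notation "'int' f" := (mu.-integrable D (fun z => (f z)%:E))
  (at level 10, f at level 8).
Local Notation functional := (functional mu D g k).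
Local Notation finite_functional := (finite_functional mu D g k).

(** The midpoint gap is nonnegative and its integral is at most 0. *)
Lemma functional_minimizer_unique a b :
  finite_functional a -> finite_functional b -> functional a = functional b ->
  functional a <= functional (fun z => (a z + b z) / 2) ->
  {ae mu, forall z, D z -> 0 < k z -> a z = b z}.
Proof.
move=> ia ib ab am; have [igap gapE] := functional_midgap mD gP mk k0 ia ib.
have gap0 z : 0 <= midgap (a z) (b z) * k z by apply: mulr_ge0 (k0 z); exact: midgap_ge0 gP _ _.
have I0 : 0 <= (\int[mu]_(z in D) (midgap (a z) (b z) * k z))%R.
  by apply: Rintegral_ge0 => z _; exact: gap0.
have I1 : (\int[mu]_(z in D) (midgap (a z) (b z) * k z))%R = 0.
  have midxx (x : R) : (x + x) / 2 = x by field.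
  by apply: le_anti; rewrite I0 andbT gapE -ab midxx subr_le0.
have int0 : (\int[mu]_(z in D) `|(midgap (a z) (b z) * k z)%:E| = 0)%E.
  transitivity (\int[mu]_(z in D) (midgap (a z) (b z) * k z)%:E)%E.
    by apply: eq_integral => z _; apply: gee0_abs; rewrite lee_fin; exact: gap0.
  by rewrite -(fineK (integrable_fin_num mD igap)); congr EFin; exact: I1.
move/(ae_eq_integral_abs mu mD (measurable_int _ igap)) : int0.
apply: filterS => z /= z0 Dz kz; have /eqP := z0 Dz.
rewrite eqe mulf_eq0 (gt_eqF kz) orbF => gapz.
by apply: contraTeq gapz => /(midgap_gt0 gP)/gt_eqF ->.
Qed.

(** The first variation is the limit of those at a + t c, t > 0, which are
    nonnegative by first-order convexity at a + t c; convergence is dominated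
    because both a and c have finite energy. *)
Lemma first_variation_ge0 a c : finite_functional a -> finite_functional c ->
  (forall t : R, 0 < t -> functional a <= functional (fun z => a z + t * c z)) ->
  0 <= (\int[mu]_(z in D) (phi (a z) * c z * k z))%R.
Proof.
move=> ia ic min_a.
pose at_ (n : nat) z := a z + n.+1%:R^-1 * c z.
have iat n : finite_functional (at_ n).
  exact (finite_functionalD mD gP mk k0 ia (finite_functionalZ mD gP mk k0 _ ic)).
have var_n n : 0 <= (\int[mu]_(z in D) (phi (at_ n z) * c z * k z))%R.
  have n0 : 0 < n.+1%:R^-1 :> R by rewrite invr_gt0.
  have := functional_above mD gP mk k0 (iat n) ia.
  have := min_a _ n0; rewrite -/(at_ n).
  have iphi := integrable_phiM mD gP mk k0 (iat n) ic.
  under eq_Rintegral => z _.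
    have -> : phi (at_ n z) * (a z - at_ n z) * k z =
      - n.+1%:R^-1 * (phi (at_ n z) * c z * k z) by rewrite /at_; ring.
    over.
  rewrite (RintegralZl _ mD iphi) => min_n /le_trans/(_ min_n).
  by rewrite gerDl mulNr oppr_le0 pmulr_rge0.
have [C C0 CP] := Phi_quasiadditive gP.
pose dom z := (q * C) * (Phi (a z) * k z) + (q * (C + 1)) * (Phi (c z) * k z).
have idom : int dom by exact: (integrable_linear mD (q * C) (q * (C + 1)) ia.2 ic.2).
have mphi b : finite_functional b -> measurable_fun D (fun z => phi (b z) * c z * k z).
  move=> ib; apply/measurable_EFinP.
  exact: (measurable_int _ (integrable_phiM mD gP mk k0 ib ic)).
have [_ _ cvg_int] : [/\ int (fun z => phi (a z) * c z * k z),
  (\int[mu]_(z in D) `|(phi (at_ n z) * c z * k z)%:E - (phi (a z) * c z * k z)%:E|)%E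
    @[n --> \oo] --> 0%E &
  (\int[mu]_(z in D) (phi (at_ n z) * c z * k z)%:E)%E @[n --> \oo] -->
  (\int[mu]_(z in D) (phi (a z) * c z * k z)%:E)%E].
  apply: (dominated_convergence mD _ _ _ idom).
  - by move=> n; apply/measurable_EFinP/mphi.
  - exact/measurable_EFinP/mphi.
  - apply: aeW => z _.
    have atz : at_ n z @[n --> \oo] --> a z.
      have := cvgD (cvg_cst (a z)) (cvgM (@cvg_harmonic R) (cvg_cst (c z))).
      by rewrite mul0r addr0; apply.
    have phiz : phi (at_ n z) @[n --> \oo] --> phi (a z).
      by apply: continuous_cvg atz; exact: continuous_phi gP (a z).
    have := cvgM (cvgM phiz (cvg_cst (c z))) (cvg_cst (k z)).
    by move=> cv; apply: cvg_EFin; [exact: nearW|exact: cv].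
  - apply: aeW => z n _; rewrite abse_EFin lee_fin normrM (ger0_norm (k0 z)).
    rewrite /dom !mulrA -mulrDl ler_wpM2r//.
    apply: le_trans (normr_phiM_le gP _ _) _.
    have q0 : 0 <= q.
      by have /andP[p1 pq] := growth_exponents gP; apply: le_trans pq; lra.
    rewrite -!mulrA -mulrDr ler_wpM2l// mulrDl mul1r addrA lerD2r -mulrDr.
    apply: le_trans (CP _ _) _; rewrite ler_wpM2l// lerD2l (le_Phi gP)//.
    rewrite normrM ler_piMl// ger0_norm ?invr_ge0//.
    by rewrite invf_le1 ?ler1n.
apply: fine_ge0; rewrite -(cvg_lim _ cvg_int)//; apply: lime_ge.
  by apply/cvg_ex; eexists; exact: cvg_int.
apply: nearW => n; have iphi := integrable_phiM mD gP mk k0 (iat n) ic.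
by rewrite -(fineK (integrable_fin_num mD iphi)) lee_fin; exact: var_n.
Qed.

End minimization.

Section minimizing_sequences.
Context d (T : measurableType d) (R : realType).
Variables (mu : {measure set T -> \bar R}) (D : set T) (mD : measurable D).
Context (g : R -> R) (p q : R) (gP : growth_condition g p q).
Variables (k : T -> R) (mk : measurable_fun D k) (k0 : forall z, 0 <= k z).

Local Notation Phi := (Phi g).
Local Notation midgap := (midgap g).
Local Notation functional := (functional mu D g k).
Local Notation finite_functional := (finite_functional mu D g k).

(** Fatou's lemma; the densities vanish where k does, so that convergence is
    only needed where k is positive. *)
Lemma functional_lower_semicontinuous (b : nat -> T -> R) (a : T -> R) (m : R)
    (r : nat -> R) :
  (forall i, finite_functional (b i)) -> measurable_fun D a ->
  {ae mu, forall z, D z -> 0 < k z -> b i z @[i --> \oo] --> a z} ->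
  (forall i, functional (b i) <= m + r i) -> r i @[i --> \oo] --> 0 ->
  finite_functional a /\ functional a <= m.
Proof.
move=> ib ma ba bm r0.
pose f i z := (Phi (b i z) * k z)%:E.
have mf i : measurable_fun D (f i).
  by apply/measurable_EFinP; exact: (measurable_density gP mk (ib i).1).
have f0 i z : D z -> (0 <= f i z)%E.
  by move=> _; rewrite lee_fin; exact: (density_ge0 gP k0).
have lim_le : (limn_einf (fun i => \int[mu]_(z in D) f i z) <= m%:E)%E.
  have mr : (m + r i)%:E @[i --> \oo] --> m%:E.
    apply: cvg_EFin; first exact: nearW.
    by rewrite -[X in _ --> X]addr0; apply: cvgD => //; exact: cvg_cst.
  rewrite limn_einf_lim -(cvg_lim _ mr)//; apply: lee_lim.
  - exact: is_cvg_einfs.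
  - by apply/cvg_ex; eexists; exact: mr.
  - apply: nearW => i; apply: (@le_trans _ _ (\int[mu]_(z in D) f i z)%E).
      by apply: ereal_inf_lbound; exists i => /=.
    by rewrite -(functionalE mD (ib i)) lee_fin.
have mlim : measurable_fun D (fun z => limn_einf (f ^~ z)).
  rewrite /limn_einf; apply: measurableT_comp => //.
  by apply: measurable_fun_limn_esup => i; apply: measurableT_comp => //; exact: mf.
have mfa : measurable_fun D (fun z => (Phi (a z) * k z)%:E).
  by apply/measurable_EFinP; exact: (measurable_density gP mk ma).
have int_le : (\int[mu]_(z in D) (Phi (a z) * k z)%:E <= m%:E)%E.
  apply: le_trans lim_le; apply: le_trans (fatou mu mD mf f0).
  rewrite le_eqVlt; apply/orP; left; apply/eqP.
  apply: ge0_ae_eq_integral => //.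
  - by move=> z _; rewrite lee_fin; exact: (density_ge0 gP k0).
  - move=> z Dz; rewrite limn_einf_lim; apply: lime_ge; first exact: is_cvg_einfs.
    by apply: nearW => i; apply: le_ereal_inf_tmp => _ [j _ <-]; exact: f0.
  apply: filterS ba => z baz Dz; apply/esym.
  have [kz|kz] := eqVneq (k z) 0.
    rewrite /f kz mulr0; under eq_fun do rewrite mulr0.
    by have [] := cvg_limn_einf_sup (cvg_cst (0%:E : \bar R)).
  have {}kz : 0 < k z by rewrite lt_neqAle eq_sym kz k0.
  have cv : f i z @[i --> \oo] --> (Phi (a z) * k z)%:E.
    apply: cvg_EFin; first exact: nearW.
    apply: cvgM; last exact: cvg_cst.
    by apply: continuous_cvg (baz Dz kz); exact: (continuous_Phi gP).
  by have [] := cvg_limn_einf_sup cv.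
have fa : finite_functional a.
  exact: (finite_functional_lty gP mk k0 ma (le_lt_trans int_le (ltry _))).
by split => //; rewrite -lee_fin (functionalE mD fa).
Qed.

(** The weighted sum of the densities and of the gaps between consecutive terms
    is integrable, hence almost everywhere finite; the pointwise criterion for
    convergence applies there. *)
Lemma minimizing_sequence_cvg :
  exists2 r : nat -> R, (forall i, 0 < r i <= 2^-1 ^+ i) &
  forall (m : R) (b : nat -> T -> R), 0 <= m ->
  (forall i, finite_functional (b i)) ->
  (forall i, functional (b i) <= m + r i) ->
  (forall i, functional (b i.+1) <= m + r i) ->
  (forall i, m <= functional (fun z => (b i z + b i.+1 z) / 2)) ->
  {ae mu, forall z, D z -> 0 < k z -> cvgn (fun i => b i z)}.
Proof.
have [c c0 cP] := midgap_cvg gP.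
have h0 i : 0 < 2^-1 ^+ i :> R by rewrite exprn_gt0// invr_gt0.
have c1 i : 0 < 1 + c i by rewrite addr_gt0.
have cr i : c i * (2^-1 ^+ i / (1 + c i)) <= 2^-1 ^+ i.
  rewrite mulrCA ler_piMr ?(ltW (h0 i))// ler_pdivrMr// mul1r; have := c0 i; lra.
have r1 i : 2^-1 ^+ i / (1 + c i) <= 1.
  rewrite ler_pdivrMr// mul1r.
  have : 2^-1 ^+ i <= 1 :> R by rewrite exprn_ile1 ?invr_ge0// invf_le1// ler1n.
  by have := c0 i; lra.
have arith (x y w ri hi ci n : R) : x <= n + ri -> y <= n + ri -> n <= w ->
    ci * ri <= hi -> 0 < ci -> 0 < hi -> ri <= 1 ->
    hi * x + ci * ((x + y) / 2 - w) <= hi * (n + 2).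
  move=> xn yn wn cri ci0 hi0 ri1.
  have : hi * x <= hi * (n + 1) by rewrite ler_pM2l//; lra.
  have : ci * ((x + y) / 2 - w) <= ci * ri by rewrite ler_pM2l//; lra.
  by lra.
have halfE (n : R) i : (2 * (n + 2)) / (2 ^ (i + 1))%:R = 2^-1 ^+ i * (n + 2).
  by rewrite addn1 expnS natrM natrX invfM exprVn; field; rewrite expf_neq0.
exists (fun i => 2^-1 ^+ i / (1 + c i)) => [i|m b m0 ib bm bm' mid_m].
  rewrite divr_gt0//= ler_pdivrMr// ler_peMr ?(ltW (h0 i))//.
  by have := c0 i; lra.
pose F i z := 2^-1 ^+ i * (Phi (b i z) * k z) +
  c i * (midgap (b i z) (b i.+1 z) * k z).
have dens0 i z : 0 <= Phi (b i z) * k z by exact: (density_ge0 gP k0).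
have gap0 i z : 0 <= midgap (b i z) (b i.+1 z) * k z.
  by apply: mulr_ge0 (k0 z); exact: (midgap_ge0 gP).
have wgap0 i z : 0 <= c i * (midgap (b i z) (b i.+1 z) * k z).
  by apply: mulr_ge0 (gap0 i z); exact: ltW.
have wdens0 i z : 0 <= 2^-1 ^+ i * (Phi (b i z) * k z).
  by apply: mulr_ge0 (dens0 i z); exact: ltW.
have F0 i z : 0 <= F i z by exact: addr_ge0.
have iF i : mu.-integrable D (fun z => (F i z)%:E).
  have [igap _] := functional_midgap mD gP mk k0 (ib i) (ib i.+1).
  exact: (integrable_linear mD _ _ (ib i).2 igap).
have intF i : (\int[mu]_(z in D) (F i z)%:E <= ((2 * (m + 2)) / (2 ^ (i + 1))%:R)%:E)%E.
  have [igap gapE] := functional_midgap mD gP mk k0 (ib i) (ib i.+1).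
  rewrite -(fineK (integrable_fin_num mD (iF i))) lee_fin.
  have -> : fine (\int[mu]_(z in D) (F i z)%:E) = 2^-1 ^+ i * functional (b i) +
      c i * (\int[mu]_(z in D) (midgap (b i z) (b i.+1 z) * k z))%R.
    rewrite -(RintegralZl _ mD igap) -(RintegralZl _ mD (ib i).2).
    exact: (RintegralD mD (integrableZl mD _ (ib i).2) (integrableZl mD _ igap)).
  rewrite gapE halfE.
  exact: (arith _ _ _ _ _ _ _ (bm i) (bm' i) (mid_m i) (cr i) (c0 i) (h0 i) (r1 i)).
have mF i : measurable_fun D (fun z => (F i z)%:E) by exact: measurable_int (iF i).
pose S z := (\sum_(i <oo) (F i z)%:E)%E.
have S0 z : (0 <= S z)%E by apply: nneseries_ge0 => i _ _; rewrite lee_fin.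
have mS : measurable_fun D S.
  by apply: ge0_emeasurable_sum => // i z _ _; rewrite lee_fin.
have intS : (\int[mu]_(z in D) S z < +oo)%E.
  rewrite integral_nneseries//; last by move=> i z _; rewrite lee_fin.
  apply: (@le_lt_trans _ _
    (\sum_(i <oo) ((2 * (m + 2)) / (2 ^ (i + 1))%:R)%:E)%E).
    apply: lee_nneseries => // i _ _.
    by apply: integral_ge0 => z _; rewrite lee_fin.
  by rewrite (cvg_lim _ (@cvg_geometric_eseries_half R (2 * (m + 2)) 0))// ltry.
have iS : mu.-integrable D S.
  apply/integrableP; split => //.
  rewrite (eq_integral S)// => z _; exact: (gee0_abs (S0 z)).
apply: filterS (integrable_ae mD iS) => z Sfin Dz kz.
have FS i : F i z <= fine (S z).
  rewrite -lee_fin (fineK (Sfin Dz)) /S.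
  rewrite (@nneseriesD1 _ (fun j => (F j z)%:E) i xpredT)//; last first.
    by move=> j _; rewrite lee_fin.
  by rewrite leeDl// nneseries_ge0// => j _ _; rewrite lee_fin.
apply: (cP _ (fine (S z) / k z)) => i.
- have := le_trans _ (FS i); rewrite /F => /(_ (2^-1 ^+ i * (Phi (b i z) * k z))).
  rewrite lerDl wgap0 => /(_ isT).
  rewrite mulrA -ler_pdivlMr// exprVn => h; rewrite -ler_pdivrMr ?exprn_gt0//.
  by rewrite mulrC.
- have := le_trans _ (FS i); rewrite /F.
  move=> /(_ (c i * (midgap (b i z) (b i.+1 z) * k z))).
  by rewrite lerDr wdens0 => /(_ isT); rewrite mulrA -ler_pdivlMr.
Qed.

End minimizing_sequences.

(** * The Lebesgue structures on the Euclidean space *)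

Section lebesgue_Rn.
Context (R : realType) (n : nat).

(** An open set is the union of the boxes with rational centre and rational
    radius that it contains. *)
Lemma open_measurable_borelRn (A : set 'rV[R]_n) :
  open A -> measurable (A : set (borelRn R n)).
Proof.
move=> oA.
pose box (i : 'rV[rat]_n * rat) := [set x : borelRn R n | forall j,
  ratr (i.1 ord0 j) - ratr i.2 <= coordRn j x <= ratr (i.1 ord0 j) + ratr i.2].
have -> : A = \bigcup_(i in [set i | box i `<=` A]) box i.
  apply/seteqP; split => [x Ax|x [i iA ix]]; last exact: iA.
  have /nbhs_ballP[e /= e0 eA] : nbhs x A by exact: open_nbhs_nbhs.
  have e2 : 0 < e / 2 by rewrite divr_gt0.
  have [r] := rat_in_itvoo e2; rewrite in_itv/= => /andP[r0 re].
  have /choice[c cP] (j : 'I_n) : exists c : rat,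
      x ord0 j - ratr r < ratr c < x ord0 j + ratr r.
    have xr : x ord0 j - ratr r < x ord0 j + ratr r by lra.
    by have [c] := rat_in_itvoo xr; rewrite in_itv/=; exists c.
  exists (\row_j c j, r) => /=.
    move=> y /= cy; apply: eA; split => // i j.
    rewrite (ord1 i) /ball/= ltr_norml.
    have := cy j; have := cP j; rewrite mxE /coordRn; lra.
  by move=> j; have := cP j; rewrite mxE /coordRn; lra.
rewrite bigcup_mkcond; apply: countable_bigcupT_measurable => // i.
by case: ifP => // _; exact: measurable_boxRn.
Qed.

Lemma measurable_lebRn (A : set 'rV[R]_n) :
  measurable (A : set (borelRn R n)) -> measurable (A : set (lebRn R n)).
Proof. exact: (@completed_measurable _ (borelRn R n) R (@lebesgue_borelRn R n)). Qed.

Lemma open_measurable_lebRn (A : set 'rV[R]_n) :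
  open A -> measurable (A : set (lebRn R n)).
Proof. by move=> /open_measurable_borelRn; exact: measurable_lebRn. Qed.

Lemma measurable_fst_lebRn2 :
  @measurable_fun _ _ (lebRn2 R n) (lebRn R n) [set: lebRn2 R n] fst.
Proof. exact: measurable_fst_completed. Qed.

Lemma measurable_snd_lebRn2 :
  @measurable_fun _ _ (lebRn2 R n) (lebRn R n) [set: lebRn2 R n] snd.
Proof. exact: measurable_snd_completed. Qed.

Lemma measurable_enorm_lebRn2 :
  measurable_fun [set: lebRn2 R n] (fun z => enorm (z.1 - z.2)).
Proof.
apply: (@completed_measurable_fun _ (borelRn R n * borelRn R n)%type).
rewrite /enorm.
under eq_fun do under eq_bigr do rewrite !mxE.
apply: measurableT_comp; first exact: continuous_measurable_fun (@sqrt_continuous R).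
apply: measurable_sum => i; apply: measurable_funX; apply: measurable_funB.
- exact: measurableT_comp (measurable_coordRn i) measurable_fst.
- exact: measurableT_comp (measurable_coordRn i) measurable_snd.
Qed.

Lemma measurable_COmega (A : set 'rV[R]_n) : open A -> measurable (COmega A).
Proof.
move=> /open_measurable_lebRn mA; apply: measurableU.
- rewrite (_ : _ `*` _ = [set: lebRn2 R n] `&` fst @^-1` A).
    exact: measurable_fst_lebRn2.
  by apply/seteqP; split => x [].
- rewrite (_ : _ `*` _ = [set: lebRn2 R n] `&` snd @^-1` A).
    exact: measurable_snd_lebRn2.
  by apply/seteqP; split => x [].
Qed.

Lemma ae_fst_lebRn2 (P : set 'rV[R]_n) : {ae lebesgueRn R n, forall x, P x} ->
  {ae lebesgueRn2 R n, forall z, P z.1}.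
Proof.
move=> /negligible_completed/negligible_setXT => N.
by apply: negligibleS (completed_negligible (N _ _ _)) => z Pz; split.
Qed.

Lemma ae_snd_lebRn2 (P : set 'rV[R]_n) : {ae lebesgueRn R n, forall x, P x} ->
  {ae lebesgueRn2 R n, forall z, P z.2}.
Proof.
move=> /negligible_completed/negligible_setTX => N.
by apply: negligibleS (completed_negligible (N _ _ _)) => z Pz; split.
Qed.

Lemma ae_section_lebRn2 (P : set ('rV[R]_n * 'rV[R]_n)) :
  {ae lebesgueRn2 R n, forall z, P z} ->
  {ae lebesgueRn R n, forall x, {ae lebesgueRn R n, forall y, P (x, y)}}.
Proof.
move=> /negligible_completed/ae_negligible_xsection N.
apply: (@completed_negligible _ (borelRn R n) R (@lebesgue_borelRn R n)).
apply: negligibleS N => x; apply: contra_not => Nx.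
apply: (@completed_negligible _ (borelRn R n) R (@lebesgue_borelRn R n)).
by apply: negligibleS Nx => y Pxy; rewrite /xsection/=; exact/mem_set.
Qed.

Lemma ae_section_integral_lebRn2 (h : 'rV[R]_n * 'rV[R]_n -> \bar R) :
  measurable_fun [set: lebRn2 R n] h -> (forall z, (0 <= h z)%E) ->
  (\int[lebesgueRn2 R n]_z h z < +oo)%E ->
  {ae lebesgueRn R n, forall x,
    measurable_fun [set: lebRn R n] (fun y => h (x, y)) /\
    (\int[lebesgueRn R n]_y h (x, y) < +oo)%E}.
Proof.
move=> mh h0 hoo.
apply: (@completed_negligible _ (borelRn R n) R (@lebesgue_borelRn R n)).
exact: ae_section_integral_lty.
Qed.

End lebesgue_Rn.

(** * Bounded domains *)

Section bounded_domains.
Context (R : realType) (n : nat).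

Lemma enorm_ge0 (x : 'rV[R]_n) : 0 <= enorm x.
Proof. exact: sqrtr_ge0. Qed.

Lemma enorm_eq0 (x : 'rV[R]_n) : (enorm x == 0) = (x == 0).
Proof.
have s0 : forall i, true -> 0 <= x ord0 i ^+ 2 by move=> i _; exact: sqr_ge0.
rewrite /enorm sqrtr_eq0 le_eqVlt ltNge sumr_ge0// orbF.
apply/idP/eqP => [|->]; last by rewrite big1// => i _; rewrite mxE expr0n.
rewrite psumr_eq0// => /allP x0; apply/rowP => i; rewrite mxE.
by have := x0 i (mem_index_enum i); rewrite sqrf_eq0 => /eqP.
Qed.

Lemma bounded_set_box (A : set 'rV[R]_n) : bounded_set A ->
  exists2 M : R, 0 < M & forall x, A x -> forall i, `|x ord0 i| <= M.
Proof.
move=> /ex_strict_bound_gt0[M M0 AM]; exists M => // x Ax i.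
apply: le_trans (ltW (AM x Ax)); rewrite [leRHS]mx_normrE.
exact: (le_bigmax _ (fun ij : 'I_1 * 'I_n => `|x ij.1 ij.2|) (ord0, i)).
Qed.

Lemma enorm_bounded (A : set 'rV[R]_n) (x : 'rV[R]_n) : bounded_set A ->
  exists2 L : R, 0 < L & forall y, A y -> enorm (x - y) <= L.
Proof.
move=> /bounded_set_box[M M0 AM].
exists (1 + Num.sqrt (\sum_(i < n) (`|x ord0 i| + M) ^+ 2)) => [|y Ay].
  by rewrite ltr_pwDl// sqrtr_ge0.
rewrite /enorm -[leLHS]add0r lerD// ler_wsqrtr// ler_sum// => i _.
rewrite !mxE -real_normK ?num_real// lerXn2r ?nnegrE ?addr_ge0 ?(ltW M0)//.
by rewrite (le_trans (ler_normB _ _))// lerD2l AM.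
Qed.

Lemma bounded_lebesgue_lty (A : set 'rV[R]_n) : open A -> bounded_set A ->
  (lebesgueRn R n A < +oo)%E.
Proof.
move=> oA /bounded_set_box[M M0 AM].
pose B := [set x : 'rV[R]_n | forall i, - M <= x ord0 i <= M].
have muB : lebesgueRn R n B = (\prod_(i < n) (M - - M))%:E.
  by apply: lebesgueRn_box => i; lra.
apply: (@le_lt_trans _ _ (lebesgueRn R n B)); last by rewrite muB ltry.
apply: le_measure; rewrite ?inE.
- exact: open_measurable_lebRn.
- exact: measurable_lebRn (measurable_boxRn _ _).
- by move=> x Ax i; rewrite -ler_norml; exact: AM.
Qed.

(** The complement of a bounded set has positive measure, so that it meets
    every set of full measure. *)
Lemma ae_outside_bounded (A : set 'rV[R]_n) (P : set 'rV[R]_n) : (0 < n)%N ->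
  bounded_set A -> {ae lebesgueRn R n, forall x, P x} ->
  exists2 x, ~ A x & P x.
Proof.
move=> n0 /bounded_set_box[M M0 AM] aeP.
pose B := [set x : 'rV[R]_n | forall i, M + 1 <= x ord0 i <= M + 2].
have muB : lebesgueRn R n B = 1%:E.
  rewrite /B lebesgueRn_box => [|i]; last by lra.
  by rewrite (eq_bigr (fun=> 1)) ?big1// => i _; ring.
apply: contrapT => noP.
have : (lebesgueRn R n).-negligible B.
  apply: negligibleS aeP => x Bx Px; apply: noP; exists x => // Ax.
  have := Bx (Ordinal n0); have := AM x Ax (Ordinal n0).
  by rewrite ler_norml; lra.
move=> /measure_negligible -/(_ (measurable_lebRn (measurable_boxRn _ _))).
by rewrite [LHS]muB => /eqP; rewrite eqe oner_eq0.
Qed.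

End bounded_domains.

(** * Difference quotients and the fractional space *)

Lemma measurable_fun_inv_ge0 d (T : measurableType d) (R : realType) (A : set T)
    (f : T -> R) : measurable_fun A f -> (forall x, 0 <= f x) ->
  measurable_fun A (fun x => (f x)^-1).
Proof.
move=> mf f0; rewrite (_ : (fun _ => _) = (fun y => y `^ (- 1)) \o f).
  by apply: measurableT_comp => //; exact: measurable_powR.
by apply/funext => x /=; rewrite powR_inv1.
Qed.

Section difference_quotients.
Context (R : realType) (n : nat) (Omega : set 'rV[R]_n) (s : R).
Context (g : R -> R) (K : 'rV[R]_n -> 'rV[R]_n -> \bar R).
Context (lambda Lambda : R).
Hypotheses (n_gt0 : (0 < n)%N) (KP : kernel_condition lambda Lambda K).
Implicit Types (u v : 'rV[R]_n -> R) (z : 'rV[R]_n * 'rV[R]_n).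

Local Notation mu := (lebesgueRn R n).
Local Notation mu2 := (lebesgueRn2 R n).
Local Notation D := (COmega Omega).

(** Signed version of the difference quotient, linear in the function. *)
Definition quot v z : R := (v z.1 - v z.2) / enorm (z.1 - z.2) `^ s.

Definition riesz_weight z : R := (enorm (z.1 - z.2) ^+ n)^-1.

(** The kernel is infinite on the diagonal, where fine makes it 0; the integrands
    vanish there anyway. *)
Definition kernel_weight z : R := fine (K z.1 z.2).

Lemma normr_quot v z : `|quot v z| = diff_quot s v z.1 z.2.
Proof. by rewrite /quot /diff_quot normrM normfV [X in _ / X]ger0_norm// powR_ge0. Qed.

Lemma quot_diag v z : z.1 = z.2 -> quot v z = 0.
Proof. by move=> z12; rewrite /quot z12 subrr mul0r. Qed.

Lemma quotK v z : quot v z * enorm (z.1 - z.2) `^ s = v z.1 - v z.2.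
Proof.
have [z12|z12] := eqVneq z.1 z.2; first by rewrite quot_diag// z12 !subrr mul0r.
rewrite /quot divfK// gt_eqF// powR_gt0// lt_neqAle enorm_ge0 andbT eq_sym.
by rewrite enorm_eq0 subr_eq0.
Qed.

Lemma quot_linear u v t :
  quot (fun x => u x + t * v x) = fun z => quot u z + t * quot v z.
Proof. by apply/funext => z; rewrite /quot; ring. Qed.

Lemma quotB u v : quot (fun x => u x - v x) = fun z => quot u z - quot v z.
Proof. by apply/funext => z; rewrite /quot; ring. Qed.

Lemma quotN u : quot (fun x => - u x) = fun z => - quot u z.
Proof. by apply/funext => z; rewrite /quot; ring. Qed.

Lemma quot_mid u v :
  quot (fun x => (u x + v x) / 2) = fun z => (quot u z + quot v z) / 2.
Proof. by apply/funext => z; rewrite /quot; ring. Qed.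

Lemma measurable_quot v : measurable_fun [set: lebRn R n] v ->
  measurable_fun [set: lebRn2 R n] (quot v).
Proof.
move=> mv; apply: measurable_funM.
- apply: measurable_funB.
  + exact: (measurableT_comp mv (@measurable_fst_lebRn2 R n)).
  + exact: (measurableT_comp mv (@measurable_snd_lebRn2 R n)).
- apply: measurable_fun_inv_ge0 => [|z]; last exact: powR_ge0.
  apply: (@measurableT_comp _ _ _ _ _ _ (@powR R ^~ s)); last exact: measurable_enorm_lebRn2.
  exact: measurable_powR.
Qed.

Lemma measurable_riesz_weight : measurable_fun [set: lebRn2 R n] riesz_weight.
Proof.
apply: measurable_fun_inv_ge0 => [|z]; last exact/exprn_ge0/enorm_ge0.
by apply: measurable_funX; exact: measurable_enorm_lebRn2.
Qed.

Lemma measurable_kernel_weight : measurable_fun [set: lebRn2 R n] kernel_weight.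
Proof. exact: (measurableT_comp _ (kernel_meas KP)). Qed.

Lemma riesz_weight_ge0 z : 0 <= riesz_weight z.
Proof. by rewrite invr_ge0 exprn_ge0// enorm_ge0. Qed.

Lemma kernel_weight_ge0 z : 0 <= kernel_weight z.
Proof. by rewrite fine_ge0// ltW// (kernel_gt0 KP). Qed.

Lemma kernel_weight_diag z : z.1 = z.2 -> kernel_weight z = 0.
Proof.
move=> z12; have /andP[+ _] := kernel_bounds KP z.1 z.2.
have /andP[l0 _] := kernel_constants KP.
rewrite /kernel_weight z12 subrr.
have -> : enorm (0 : 'rV[R]_n) = 0 by apply/eqP; rewrite enorm_eq0.
rewrite expr0n gtn_eqF//= inve0 gt0_muley ?lte_fin//.
by rewrite leye_eq => /eqP ->.
Qed.

Lemma kernel_bounds_offdiag z : z.1 != z.2 ->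
  K z.1 z.2 = (kernel_weight z)%:E /\
  lambda * riesz_weight z <= kernel_weight z <= Lambda * riesz_weight z.
Proof.
move=> z12; have := kernel_bounds KP z.1 z.2.
have e0 : enorm (z.1 - z.2) ^+ n != 0.
  by rewrite expf_neq0// enorm_eq0 subr_eq0.
rewrite inver (negbTE e0) -!EFinM /kernel_weight => /andP[lK KL].
have Kfin : K z.1 z.2 \is a fin_num.
  rewrite ge0_fin_numE ?(le_lt_trans KL) ?ltry//.
  exact/ltW/(kernel_gt0 KP).
by rewrite -!lee_fin fineK// lK KL.
Qed.

Lemma kernel_weight_bounds z :
  lambda * riesz_weight z <= kernel_weight z <= Lambda * riesz_weight z.
Proof.
have [z12|/kernel_bounds_offdiag[]//] := eqVneq z.1 z.2.
rewrite kernel_weight_diag// /riesz_weight z12 subrr.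
have -> : enorm (0 : 'rV[R]_n) = 0 by apply/eqP; rewrite enorm_eq0.
by rewrite expr0n gtn_eqF//= invr0 !mulr0 lexx.
Qed.

Lemma kernel_weight_gt0 z : z.1 != z.2 -> 0 < kernel_weight z.
Proof.
move=> z12; have [_ /andP[+ _]] := kernel_bounds_offdiag z12; apply: lt_le_trans.
have /andP[l0 _] := kernel_constants KP.
rewrite mulr_gt0// invr_gt0 exprn_gt0// lt_neqAle enorm_ge0 andbT eq_sym.
by rewrite enorm_eq0 subr_eq0.
Qed.

Lemma kernel_mulE (f : R) z : (z.1 = z.2 -> f = 0) ->
  (f%:E * K z.1 z.2 = (f * kernel_weight z)%:E)%E.
Proof.
move=> f0; have [z12|z12] := eqVneq z.1 z.2.
  by rewrite f0// mul0r mul0e.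
by have [-> _] := kernel_bounds_offdiag z12; rewrite EFinM.
Qed.

Lemma energyE v : energy Omega s g K v =
  (\int[mu2]_(z in D) (Phi g (quot v z) * kernel_weight z)%:E)%E.
Proof.
apply: eq_integral => z _; rewrite -normr_quot -PhiE kernel_mulE// => z12.
by rewrite quot_diag// (Phi0 g).
Qed.

(** The sign of the increment of u is that of its quotient, and the remaining
    power of the distance turns the increment of v into a quotient. *)
Lemma weak_formE u v : weak_form Omega s g K u v =
  (\int[mu2]_(z in D) (phi g (quot u z) * quot v z * kernel_weight z)%:E)%E.
Proof.
apply: eq_integral => z _; rewrite kernel_mulE; last first.
  by move=> z12; rewrite z12 !subrr mulr0.
rewrite -EFinM -normr_quot; congr EFin.
rewrite phiE mulrAC; congr (_ * _).
rewrite /quot -!mulrA; congr (_ * _).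
have [z12|z12] := eqVneq z.1 z.2; first by rewrite z12 subrr !mul0r.
have e0 : 0 < enorm (z.1 - z.2) `^ s.
  rewrite powR_gt0// lt_neqAle enorm_ge0 andbT eq_sym.
  by rewrite enorm_eq0 subr_eq0.
rewrite normrM normfV (gtr0_norm e0) invfM invrK.
have [->|u12] := eqVneq (u z.1) (u z.2); first by rewrite subrr !mul0r.
have nu0 : `|u z.1 - u z.2| != 0 by rewrite normr_eq0 subr_eq0.
by field; rewrite nu0 (gt_eqF e0).
Qed.

End difference_quotients.

Lemma integral_affine_bound_lty d (T : measurableType d) (R : realType)
    (mu : {measure set T -> \bar R}) (A : set T) (f h : T -> \bar R) (a b : R) :
  measurable A -> (mu A < +oo)%E -> 0 <= a -> 0 <= b ->
  measurable_fun A f -> measurable_fun [set: T] h ->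
  (forall x, (0 <= f x)%E) -> (forall x, (0 <= h x)%E) ->
  (forall x, A x -> (f x <= a%:E + b%:E * h x)%E) ->
  (\int[mu]_x h x < +oo)%E -> (\int[mu]_(x in A) f x < +oo)%E.
Proof.
move=> mA Aoo a0 b0 mf mh f0 h0 fh hoo.
have mhA : measurable_fun A h by exact: measurable_funS mh.
have mbh : measurable_fun A (fun x => b%:E * h x)%E by exact: measurable_funeM.
apply: (@le_lt_trans _ _ (\int[mu]_(x in A) (a%:E + b%:E * h x))%E).
  by apply: ge0_le_integral => //; exact: emeasurable_funD.
rewrite ge0_integralD//; last by move=> x _; rewrite mule_ge0.
rewrite integral_cst// ge0_integralZl//.
apply: lte_add_pinfty; first exact: lte_mul_pinfty.
by apply: lte_mul_pinfty => //; apply: le_lt_trans hoo; exact: ge0_subset_integral.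
Qed.

Lemma finite_functional_weight d (T : measurableType d) (R : realType)
    (mu : {measure set T -> \bar R}) (D : set T) (g : R -> R) (p q : R)
    (k1 k2 : T -> R) (c : R) (a : T -> R) : measurable D ->
  growth_condition g p q -> measurable_fun D k1 -> (forall z, 0 <= k1 z) ->
  (forall z, k1 z <= c * k2 z) ->
  finite_functional mu D g k2 a -> finite_functional mu D g k1 a.
Proof.
move=> mD gP mk1 k10 k12 [ma ia]; split => //.
apply: (integrable_dominated mD _ _ (integrable_linear mD c 0 ia ia)).
  exact: (measurable_density gP mk1 ma).
move=> z _ /=; rewrite mul0r addr0 ger0_norm; last exact: (density_ge0 gP k10).
by rewrite mulrCA; apply: ler_wpM2l (k12 z); exact: (Phi_ge0 gP).
Qed.

Section fractional_space.
Context (R : realType) (n : nat) (Omega : set 'rV[R]_n) (s : R).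
Context (g : R -> R) (p q : R) (K : 'rV[R]_n -> 'rV[R]_n -> \bar R).
Context (lambda Lambda : R).
Hypotheses (n_gt0 : (0 < n)%N) (oOmega : open Omega) (bOmega : bounded_set Omega).
Hypotheses (s_gt0 : 0 < s) (gP : growth_condition g p q).
Hypothesis KP : kernel_condition lambda Lambda K.
Implicit Types (u v : 'rV[R]_n -> R) (z : 'rV[R]_n * 'rV[R]_n).

Local Notation mu := (lebesgueRn R n).
Local Notation mu2 := (lebesgueRn2 R n).
Local Notation D := (COmega Omega).
Local Notation quot := (quot s).
Local Notation riesz_weight := (@riesz_weight R n).
Local Notation kernel_weight := (kernel_weight K).

Lemma measurable_COmega_fun (h : lebRn2 R n -> R) :
  measurable_fun [set: lebRn2 R n] h -> measurable_fun D h.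
Proof. by move=> mh; apply: measurable_funS mh. Qed.

(** Poincare-type bound. By Tonelli, the density is integrable along almost
    every slice through a point x0; on the bounded domain it controls the
    increment from x0, hence the function itself. *)
Lemma finite_functional_in_LG v : measurable_fun [set: lebRn R n] v ->
  finite_functional mu2 D g riesz_weight (quot v) -> in_LG Omega g v.
Proof.
move=> mv [_ iv].
have mOmega : measurable (Omega : set (lebRn R n)) by exact: open_measurable_lebRn.
have mD := measurable_COmega oOmega.
split; first exact: measurable_funS mv.
pose h := (fun z => (Phi g (quot v z) * riesz_weight z)%:E) \_ D.
have h0 z : (0 <= h z)%E.
  apply: erestrict_ge0 => {}z _; rewrite lee_fin.
  exact: (density_ge0 (T := lebRn2 R n) gP (@riesz_weight_ge0 R n)).
have mh : measurable_fun [set: lebRn2 R n] h.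
  by apply/(measurable_restrictT _ mD); exact: (measurable_int _ iv).
have hoo : (\int[mu2]_z h z < +oo)%E.
  rewrite -integral_mkcond -ge0_fin_numE; first exact: (integrable_fin_num mD iv).
  apply: integral_ge0 => z _; rewrite lee_fin.
  exact: (density_ge0 (T := lebRn2 R n) gP (@riesz_weight_ge0 R n)).
have [x0 _ [mhx hxoo]] :=
  ae_outside_bounded n_gt0 bOmega (ae_section_integral_lebRn2 mh h0 hoo).
have [L L0 OL] := enorm_bounded x0 bOmega.
have [C C0 CP] := Phi_quasiadditive gP.
have [B B0 BP] := Phi_scale gP (L `^ s).
pose A := C * Phi g (v x0); pose M := C * B * L ^+ n.
have A0 : 0 <= A by apply: mulr_ge0 => //; exact: (Phi_ge0 gP).
have M0 : 0 <= M by rewrite !mulr_ge0// exprn_ge0// ltW.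
have bound y : Omega y -> (((primitive g `|v y|)%:E <= A%:E + M%:E * h (x0, y))%E).
  move=> Oy; have -> : h (x0, y) = (Phi g (quot v (x0, y)) * riesz_weight (x0, y))%:E.
    by rewrite /h patchE mem_set//; right.
  rewrite -EFinM -EFinD lee_fin -PhiE.
  have e0 : 0 <= enorm (x0 - y) by exact: enorm_ge0.
  have -> : v y = v x0 + - (enorm (x0 - y) `^ s * quot v (x0, y)).
    by rewrite mulrC quotK/=; ring.
  apply: le_trans (CP _ _) _; rewrite mulrDr lerD// /M -!mulrA.
  apply: ler_wpM2l => //; rewrite PhiN.
  apply: (@le_trans _ _ (Phi g (L `^ s * quot v (x0, y)))).
    apply: (le_Phi gP); rewrite !normrM ler_wpM2r// !ger0_norm ?powR_ge0//.
    by apply: ge0_ler_powR; rewrite ?nnegrE ?(ltW s_gt0) ?(ltW L0)// OL.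
  apply: le_trans (BP _) _; apply: ler_wpM2l => //.
  have [x0y|x0y] := eqVneq x0 y.
    by rewrite quot_diag// (Phi0 g) mul0r mulr0.
  rewrite mulrCA ler_peMr ?(Phi_ge0 gP)// /riesz_weight/=.
  rewrite ler_pdivlMr ?mul1r; last first.
    rewrite exprn_gt0// lt_neqAle enorm_ge0 andbT eq_sym.
    by rewrite enorm_eq0 subr_eq0.
  by rewrite lerXn2r ?nnegrE ?(ltW L0)// OL.
apply: (integral_affine_bound_lty mOmega _ A0 M0 _ mhx _ _ bound hxoo).
- exact: bounded_lebesgue_lty.
- apply/measurable_EFinP.
  apply: (measurableT_comp (measurable_Phi gP)); exact: measurable_funS mv.
- by move=> y; rewrite lee_fin -PhiE; exact: (Phi_ge0 gP).
- by move=> y; exact: h0.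
Qed.

(** The kernel is comparable to the Riesz weight, and integrability over the
    domain comes for free by the preceding bound. *)
Lemma in_WsGP v : in_WsG Omega s g v <-> measurable_fun [set: lebRn R n] v /\
  finite_functional mu2 D g kernel_weight (quot v).
Proof.
have mD := measurable_COmega oOmega.
have mk : measurable_fun D kernel_weight.
  exact/measurable_COmega_fun/(measurable_kernel_weight KP).
have mr : measurable_fun D riesz_weight.
  exact/measurable_COmega_fun/measurable_riesz_weight.
have k0 := kernel_weight_ge0 KP.
split => [[mv _ vW]|[mv vfin]].
  split => //.
  apply: (@finite_functional_weight _ (lebRn2 R n) R mu2 D g p q
    kernel_weight riesz_weight Lambda (quot v) mD gP mk k0).
    by move=> z; have /andP[_] := kernel_weight_bounds n_gt0 KP z.
  apply: (finite_functional_lty gP mr (@riesz_weight_ge0 R n)).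
    exact/measurable_COmega_fun/measurable_quot.
  apply: le_lt_trans vW; rewrite le_eqVlt; apply/orP; left; apply/eqP.
  by apply: eq_integral => z _; rewrite PhiE normr_quot.
have rfin : finite_functional mu2 D g riesz_weight (quot v).
  apply: (@finite_functional_weight _ (lebRn2 R n) R mu2 D g p q
    riesz_weight kernel_weight lambda^-1 (quot v) mD gP mr
    (@riesz_weight_ge0 R n)) => // z.
  have /andP[l0 _] := kernel_constants KP.
  have /andP[+ _] := kernel_weight_bounds n_gt0 KP z.
  by rewrite ler_pdivlMl.
have LG := finite_functional_in_LG mv rfin; split; [exact: mv|exact: LG|].
have := integrable_fin_num mD rfin.2; rewrite ge0_fin_numE; last first.
  apply: integral_ge0 => z _; rewrite lee_fin.
  exact: (density_ge0 (T := lebRn2 R n) gP (@riesz_weight_ge0 R n)).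
apply: le_lt_trans; rewrite le_eqVlt; apply/orP; left; apply/eqP.
by apply: eq_integral => z _; rewrite PhiE normr_quot.
Qed.

Lemma in_WsG_linear u v t : in_WsG Omega s g u -> in_WsG Omega s g v ->
  in_WsG Omega s g (fun x => u x + t * v x).
Proof.
move=> /in_WsGP[mu_ uf] /in_WsGP[mv vf]; apply/in_WsGP.
have mD := measurable_COmega oOmega.
have mk : measurable_fun D kernel_weight.
  exact/measurable_COmega_fun/(measurable_kernel_weight KP).
have k0 := kernel_weight_ge0 KP.
split.
  exact: (measurable_funD mu_ (measurable_funM (measurable_cst t) mv)).
rewrite quot_linear.
exact: (finite_functionalD mD gP mk k0 uf (finite_functionalZ mD gP mk k0 t vf)).
Qed.

End fractional_space.

(** * The Dirichlet problem *)

Section dirichlet.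
Context (R : realType) (n : nat) (Omega : set 'rV[R]_n) (s : R).
Context (g : R -> R) (p q : R) (K : 'rV[R]_n -> 'rV[R]_n -> \bar R).
Context (lambda Lambda : R) (f : 'rV[R]_n -> R).
Hypotheses (n_gt0 : (0 < n)%N) (oOmega : open Omega) (bOmega : bounded_set Omega).
Hypotheses (s_gt0 : 0 < s) (gP : growth_condition g p q).
Hypothesis KP : kernel_condition lambda Lambda K.
Hypothesis fW : in_WsG Omega s g f.
Implicit Types (u v : 'rV[R]_n -> R) (z : 'rV[R]_n * 'rV[R]_n).

Local Notation mu := (lebesgueRn R n).
Local Notation mu2 := (lebesgueRn2 R n).
Local Notation D := (COmega Omega).
Local Notation quot := (quot s).
Local Notation k := (kernel_weight K).
Local Notation finite_functional := (finite_functional mu2 D g k).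
Local Notation functional := (functional mu2 D g k).
Local Notation in_Af := (in_Af Omega s g f).
Local Notation minimizer := (is_minimizer Omega s g K f).

Let mD : measurable D. Proof. exact: measurable_COmega. Qed.

Let mk : measurable_fun D k.
Proof. exact/measurable_COmega_fun/(measurable_kernel_weight KP). Qed.

Let k0 : forall z, 0 <= k z. Proof. exact: (kernel_weight_ge0 KP). Qed.

Let WP := in_WsGP n_gt0 oOmega bOmega s_gt0 gP KP.

Let W_linear := in_WsG_linear n_gt0 oOmega bOmega s_gt0 gP KP.

Let ae_filter : Filter (nbhs (almost_everywhere mu)).
Proof. exact: ae_filter_ringOfSetsType. Qed.

Let ae2_filter : Filter (nbhs (almost_everywhere mu2)).
Proof. exact: ae_filter_ringOfSetsType. Qed.

Lemma in_Af_finite v : in_Af v -> finite_functional (quot v).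
Proof. by move=> [/WP[]]. Qed.

Lemma energy_functional v : finite_functional (quot v) ->
  energy Omega s g K v = (functional (quot v))%:E.
Proof. by move=> vfin; rewrite (energyE _ _ _ KP) (functionalE mD vfin). Qed.

Lemma minimizer_le u v : minimizer u -> in_Af v ->
  functional (quot u) <= functional (quot v).
Proof.
move=> [uA umin] vA; have := umin v vA.
rewrite (energy_functional (in_Af_finite uA)).
by rewrite (energy_functional (in_Af_finite vA)) lee_fin.
Qed.

Lemma in_Af_linear u v t : in_Af u -> in_WsG Omega s g v ->
  v = (fun=> 0) %[ae mu in ~` Omega] -> in_Af (fun x => u x + t * v x).
Proof.
move=> [uW uf] vW v0; split; first exact: W_linear.
move: uf v0; apply: (@filterS2 _ _ ae_filter) => x ux vx Ox.
by rewrite ux// vx// mulr0 addr0.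
Qed.

Lemma in_Af_diff u v : in_Af u -> in_Af v ->
  in_WsG Omega s g (fun x => v x - u x) /\
  (fun x => v x - u x) = (fun=> 0) %[ae mu in ~` Omega].
Proof.
move=> [uW uf] [vW vf]; split.
  have := W_linear (- 1) vW uW.
  by under eq_fun do rewrite mulN1r.
by move: uf vf; apply: (@filterS2 _ _ ae_filter) => x ux vx Ox; rewrite ux// vx// subrr.
Qed.

Lemma in_Af_mid u v : in_Af u -> in_Af v -> in_Af (fun x => (u x + v x) / 2).
Proof.
move=> uA vA; have [dW d0] := in_Af_diff uA vA.
have := in_Af_linear 2^-1 uA dW d0.
by rewrite (_ : (fun x => u x + _) = fun x => (u x + v x) / 2)//;
  apply/funext => x; field.
Qed.

(** Quotients of two minimizers coincide, so that their difference is constant;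
    the constant is 0 because both equal f at an anchor point outside Omega. *)
Lemma minimizer_unique u v : minimizer u -> minimizer v -> v = u %[ae mu].
Proof.
move=> um vm; have [uA _] := um; have [vA _] := vm.
have ufin := in_Af_finite uA; have vfin := in_Af_finite vA.
have quot_eq : {ae mu2, forall z, D z -> 0 < k z -> quot u z = quot v z}.
  apply: (functional_minimizer_unique mD gP mk k0 ufin vfin).
    by apply/le_anti/andP; split; [exact: minimizer_le um vA|exact: minimizer_le vm uA].
  by have := minimizer_le um (in_Af_mid uA vA); rewrite quot_mid.
have diff_eq : {ae mu2, forall z, D z -> u z.1 - u z.2 = v z.1 - v z.2}.
  apply: (@filterS _ _ ae2_filter) quot_eq => z uvz Dz.
  have [->|z12] := eqVneq z.1 z.2; first by rewrite !subrr.
  by rewrite -!(quotK s) uvz//; exact: (kernel_weight_gt0 KP).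
have [x0 Ox0 [ux0 [vx0 sec]]] := ae_outside_bounded n_gt0 bOmega
  (@filterI _ _ ae_filter _ _ uA.2
    (@filterI _ _ ae_filter _ _ vA.2 (ae_section_lebRn2 diff_eq))).
move: sec uA.2 vA.2; apply: (@filterS3 _ _ ae_filter) => y sec uy vy _.
have [Oy|Oy] := pselect (Omega y); last by rewrite uy// vy.
have := sec (or_intror (conj I Oy)); rewrite /= ux0// vx0//.
by move/addrI/oppr_inj.
Qed.

(** A minimizer has nonnegative first variation along eta and - eta; conversely,
    by first-order convexity the energy of v exceeds that of u by at least the
    first variation at u along v - u. *)
Lemma minimizer_weak_solution u : in_Af u ->
  minimizer u <-> dirichlet_weak_solution Omega s g K f u.
Proof.
move=> uA; have ufin := in_Af_finite uA; split => [um|[_ [_ uweak]]].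
- split; [exact: uA|split; [exact: uA.1|]].
  have var_ge0 eta : in_WsG Omega s g eta ->
      eta = (fun=> 0) %[ae mu in ~` Omega] ->
      0 <= (\int[mu2]_(z in D) (phi g (quot u z) * quot eta z * k z))%R.
    move=> etaW eta0; have [_ etafin] := (WP eta).1 etaW.
    apply: (first_variation_ge0 mD gP mk k0 ufin etafin) => t t0.
    by have := minimizer_le um (in_Af_linear t uA etaW eta0); rewrite quot_linear.
  move=> eta etaW eta0; have [_ etafin] := (WP eta).1 etaW.
  have iphi := integrable_phiM mD gP mk k0 ufin etafin.
  rewrite (weak_formE _ _ _ KP).
  rewrite -(fineK (integrable_fin_num mD iphi)); congr EFin.
  apply/le_anti/andP; split; last exact: var_ge0.
  have := var_ge0 (fun x => - eta x); rewrite quotN.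
  under eq_Rintegral do rewrite mulrN mulNr -mulN1r.
  rewrite (RintegralZl _ mD iphi) mulN1r oppr_ge0; apply.
    have := W_linear (- 2) etaW etaW.
    by rewrite (_ : (fun x => eta x + _) = fun x => - eta x)//;
      apply/funext => x; ring.
  by move: eta0; apply: (@filterS _ _ ae_filter) => x ex Ox; rewrite ex// oppr0.
- split; [exact: uA|move=> v vA].
  have vfin := in_Af_finite vA.
  have [dW d0] := in_Af_diff uA vA.
  rewrite (energy_functional ufin) (energy_functional vfin) lee_fin.
  have [_ dfin] := (WP _).1 dW.
  have := functional_above mD gP mk k0 ufin vfin.
  have := uweak _ dW d0; rewrite (weak_formE _ _ _ KP).
  rewrite quotB /Rintegral => ->.
  by rewrite addr0.
Qed.

(** A minimizing sequence whose energies converge fast enough has almost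
    everywhere convergent quotients, hence converges almost everywhere itself;
    the limit is a minimizer by lower semicontinuity. *)
Lemma minimizer_exists : exists u, minimizer u.
Proof.
have [r rP seqP] := minimizing_sequence_cvg mu2 mD gP mk k0.
have fA : in_Af f by split; [exact: fW|exact: aeW].
pose E := [set functional (quot v) | v in in_Af].
have functional_ge0 v : 0 <= functional (quot v).
  by apply: Rintegral_ge0 => z _; exact: (density_ge0 (T := lebRn2 R n) gP k0).
have infE : has_inf E.
  split; first by exists (functional (quot f)); exists f.
  by exists 0 => _ [v _ <-]; exact: functional_ge0.
pose m := inf E.
have m0 : 0 <= m.
  by apply: lb_le_inf infE.1 _ => _ [v _ <-]; exact: functional_ge0.
have m_le v : in_Af v -> m <= functional (quot v).
  by move=> vA; apply: ge_inf infE.2 _ _; exists v.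
(* the minimum puts the energies of both v i and v i.+1 within r i of m *)
have /choice[v vP] (i : nat) : exists v, in_Af v /\
    functional (quot v) <= m + Num.min (r i) (r i.-1).
  have ri0 : 0 < Num.min (r i) (r i.-1).
    by rewrite lt_min; have /andP[-> _] := rP i; have /andP[-> _] := rP i.-1.
  by have [_ [v vA <-] /ltW vm] := inf_adherent ri0 infE; exists v.
have vA i : in_Af (v i) := (vP i).1.
have vfin i : finite_functional (quot (v i)) := in_Af_finite (vA i).
have v_le i : functional (quot (v i)) <= m + r i.
  by apply: le_trans (vP i).2 _; rewrite lerD2l ge_min lexx.
have v_le' i : functional (quot (v i.+1)) <= m + r i.
  by apply: le_trans (vP i.+1).2 _; rewrite lerD2l ge_min lexx orbT.
have v_mid i : m <= functional (fun z => (quot (v i) z + quot (v i.+1) z) / 2).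
  by rewrite -quot_mid; exact: m_le (in_Af_mid (vA i) (vA i.+1)).
have cvg_diff : {ae mu2, forall z, D z -> cvgn (fun i => v i z.1 - v i z.2)}.
  apply: (@filterS _ _ ae2_filter) (seqP m _ m0 vfin v_le v_le' v_mid) => z cz Dz.
  under eq_fun do rewrite -(quotK s).
  apply: is_cvgM; last exact: is_cvg_cst.
  have [z12|z12] := eqVneq z.1 z.2.
    under eq_fun do rewrite (quot_diag _ _ z12).
    exact: is_cvg_cst.
  by apply: cz => //; exact: (kernel_weight_gt0 KP).
have v_outside : {ae mu, forall y, forall i, (~` Omega) y -> v i y = f y}.
  by apply: ae_foralln => i; exact: (vA i).2.
(* the anchor: the sequence is constant there, so that the convergence of the
   increments gives that of the values *)
have [x0 Ox0 [vx0 sec]] := ae_outside_bounded n_gt0 bOmega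
  (@filterI _ _ ae_filter _ _ v_outside (ae_section_lebRn2 cvg_diff)).
pose u y := if y \in Omega then fine (limn_esup (fun i => (v i y)%:E)) else f y.
have cvg_u : {ae mu, forall y, v i y @[i --> \oo] --> u y}.
  move: v_outside sec; apply: (@filterS2 _ _ ae_filter) => y vy cy.
  rewrite /u; have [Oy|Oy] := pselect (Omega y); last first.
    rewrite memNset//; under eq_fun do rewrite vy//.
    exact: cvg_cst.
  have := cy (or_intror (conj I Oy)); rewrite /=.
  under eq_fun do rewrite vx0//.
  move=> /cvg_ex[l cl].
  have {cl} : v i y @[i --> \oo] --> f x0 - l.
    rewrite (_ : (fun i => v i y) = fun i => f x0 - (f x0 - v i y)).
      by apply: cvgB cl; exact: cvg_cst.
    by apply/funext => i; rewrite subKr.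
  rewrite mem_set//; move: (f x0 - l) => {}l cl.
  have /cvg_limn_einf_sup[_ ->] : (v i y)%:E @[i --> \oo] --> l%:E.
    by apply: cvg_EFin; [exact: nearW|exact: cl].
  exact: cl.
have meas_u : measurable_fun [set: lebRn R n] u.
  apply: measurable_fun_ifT; last exact: ((WP f).1 fW).1.
    apply: (measurable_fun_bool true).
    rewrite setTI (_ : _ @^-1` _ = Omega); first exact: open_measurable_lebRn.
    by apply/seteqP; split => y /= Oy; [exact: set_mem|exact: mem_set].
  apply: measurableT_comp; first exact: fine_measurable.
  apply: measurable_fun_limn_esup => i.
  by apply/measurable_EFinP; exact: ((WP (v i)).1 (vA i).1).1.
have cvg_quot : {ae mu2, forall z, D z -> 0 < k z ->
    quot (v i) z @[i --> \oo] --> quot u z}.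
  move: (ae_fst_lebRn2 cvg_u) (ae_snd_lebRn2 cvg_u).
  apply: (@filterS2 _ _ ae2_filter) => z c1 c2 _ _.
  by apply: cvgM; [exact: cvgB c1 c2|exact: cvg_cst].
have r0 : r i @[i --> \oo] --> 0.
  apply: (@squeeze_cvgr _ _ _ _ (fun=> 0) (geometric 1 2^-1)).
  - by apply: nearW => i; rewrite /geometric/= mul1r; have /andP[/ltW -> ->] := rP i.
  - exact: cvg_cst.
  - by apply: cvg_geometric; rewrite ger0_norm ?invr_ge0// invf_lt1// ltr1n.
have mquot : measurable_fun D (quot u).
  exact/measurable_COmega_fun/measurable_quot.
have [ufin u_le] :=
  functional_lower_semicontinuous mD gP mk k0 vfin mquot cvg_quot v_le r0.
exists u; split; [split|].
- by apply/WP.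
- by apply: aeW => y Oy; rewrite /u memNset.
- move=> w wA; rewrite (energy_functional ufin).
  rewrite (energy_functional (in_Af_finite wA)) lee_fin.
  exact: le_trans u_le (m_le w wA).
Qed.

End dirichlet.

Theorem theorem5p5 (R : realType) (n : nat) (n_ge2 : (2 <= n)%N)
    (Omega : set 'rV[R]_n) (domOmega : is_domain Omega)
    (bndOmega : bounded_set Omega)
    (s : R) (s01 : 0 < s < 1)
    (g : R -> R) (p q : R) (gP : growth_condition g p q)
    (K : 'rV[R]_n -> 'rV[R]_n -> \bar R) (lambda Lambda : R)
    (KP : kernel_condition lambda Lambda K)
    (f : 'rV[R]_n -> R) (fW : in_WsG Omega s g f) :
  (exists2 u, is_minimizer Omega s g K f u &
     forall v, is_minimizer Omega s g K f v -> v = u %[ae lebesgueRn R n]) /\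
  (forall u, in_Af Omega s g f u ->
     (is_minimizer Omega s g K f u <->
      dirichlet_weak_solution Omega s g K f u)).
Proof.
have n_gt0 : (0 < n)%N by exact: ltn_trans n_ge2.
have [_ oOmega _] := domOmega; have /andP[s_gt0 _] := s01.
split.
- have [u um] := minimizer_exists n_gt0 oOmega bndOmega s_gt0 gP KP fW.
  exists u => // v vm.
  exact: (minimizer_unique n_gt0 oOmega bndOmega s_gt0 gP KP um vm).
- move=> u uA.
  exact: (minimizer_weak_solution n_gt0 oOmega bndOmega s_gt0 gP KP uA).
Qed.
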